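(* Let $X=(X_1,X_2,\ldots)$ be a stationary, $\psi$-mixing source with values in a finite set $\mathbb X$, let $d:\mathbb X\times\mathbb X\to[0,\infty)$ be a single-letter distortion measure with $d(x,x)=0$ for all $x$, and let $D>0$. Let $c=\langle c^n\rangle_{n\ge1}$ be a channel that directly communicates the source $X$ within distortion $D$. Then every rate $R<R^P_X(D)$ is reliably achievable over $c$.
   Context: The source reproduction alphabet is $\mathbb Y=\mathbb X$. For $x^n,y^n\in\mathbb X^n$, $d^n(x^n,y^n)=\sum_{i=1}^n d(x^n(i),y^n(i))$. For a sequence $X_a,\dots,X_b$ write $X_a^b$. $\psi$-mixing: for $\tau\in\{0,1,2,\ldots\}$ let $\psi(\tau)=\sup_{t\in\mathbb N}\sup_{\mathbb A,\mathbb B}\left|\frac{\Pr(X_1^t\in\mathbb A,\,X_{t+\tau+1}^\infty\in\mathbb B)}{\Pr(X_1^t\in\mathbb A)\Pr(X_{t+\tau+1}^\infty\in\mathbb B)}-1\right|$, where the inner supremum is over $\mathbb A\subseteq\mathbb X^t$ and Borel (product $\sigma$-field) sets $\mathbb B$ of sequences indexed by times $t+\tau+1,t+\tau+2,\ldots$, with both probabilities in the denominator positive. $X$ is $\psi$-mixing if $\psi(\tau)\to0$ as $\tau\to\infty$. Rate-distortion function under probability of excess distortion: a rate $R$ source code is a sequence $(e^n,f^n)$ with $e^n:\mathbb X^n\to\{1,\ldots,2^{\lfloor nR\rfloor}\}$, $f^n:\{1,\ldots,2^{\lfloor nR\rfloor}\}\to\mathbb X^n$; $R$ is achievable if $\lim_{n\to\infty}\Pr\big(\tfrac1n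 d^n(X^n,f^n(e^n(X^n)))>D\big)=0$; $R^P_X(D)$ is the infimum of achievable rates. Channel: $c=\langle c^n\rangle$ with $c^n:\mathbb X^n\to\mathcal P(\mathbb X^n)$, $c^n(y^n|x^n)$ the probability of output $y^n$ given input $x^n$. $c$ directly communicates $X$ within distortion $D$ if, when $X^n$ is input to $c^n$ with output $Y^n$, $\Pr(\tfrac1n d^n(X^n,Y^n)>D)\le\omega_n$ for some $\omega_n\to0$. Channel codes: with $\mathbb M_R^n=\{1,\ldots,2^{\lfloor nR\rfloor}\}$, a rate $R$ deterministic encoder is $e^n_{ch}:\mathbb M_R^n\to\mathbb X^n$ and decoder $f^n_{ch}:\mathbb X^n\to\mathbb M_R^n\cup\{\mathrm e\}$ ($\mathrm e$ = error); random codes (a joint distribution over deterministic encoder–decoder pairs) are allowed. With $g^n=e^n_{ch}\circ c^n\circ f^n_{ch}$, rate $R$ is reliably achievable over $c$ if there is a rate $R$ code and $\delta_n\to0$ with $\sup_{m\in\mathbb M_R^n} g^n(\{m\}^c|m)\le\delta_n$. *)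

(* Defs.v *)
From HB Require Import structures.
From mathcomp Require Import all_boot all_order all_algebra.
From mathcomp Require Import all_classical all_reals all_analysis.
Set Implicit Arguments. Unset Strict Implicit. Unset Printing Implicit Defensive.
Import Order.TTheory GRing.Theory Num.Theory.
Local Open Scope classical_set_scope.
Local Open Scope ring_scope.

Notation word A n := {ffun 'I_n -> A}.

Section Defs.
Variable R : realType.
Variable A : finType.

Definition dn (d : A -> A -> R) n (x y : word A n) : R := \sum_(i < n) d (x i) (y i).

Definition msize (r : R) (n : nat) : nat :=
  let k := Num.floor (n%:R * r) in if (0 <= k)%R then (2 ^ `|k|)%N else 0%N.

Definition cyl : set (set (nat -> A)) :=
  [set S | exists i (a : A), S = [set f | f i = a]].
Definition prod_measurable (B : set (nat -> A)) : Prop := <<s cyl>> B.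

Variables (d0 : measure_display) (T : measurableType d0) (P : probability T R).
Variable X : nat -> T -> A.  (* X i = X_{i+1} in the paper's 1-based indexing *)

Definition pr (E : set T) : R := fine (P E).

Definition Xn n (w : T) : word A n := [ffun i : 'I_n => X i w].
Definition Xtail s (w : T) : nat -> A := fun k => X (s + k)%N w.

Definition process (* each X_i is a random variable *) : Prop :=
  forall i (a : A), measurable (X i @^-1` [set a]).

Definition stationary : Prop :=
  forall B, prod_measurable B ->
    P [set w | B (Xtail 0 w)] = P [set w | B (Xtail 1 w)].

Definition psi (tau : nat) : \bar R :=
  ereal_sup [set v : \bar R | exists (t : nat) (Aset : {set word A t}) (B : set (nat -> A)),
     [/\ (0 < t)%N, prod_measurable B,
         0 < pr [set w | Xn t w \in Aset],
         0 < pr [set w | B (Xtail (t + tau) w)] &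
         v = (`| pr ([set w | Xn t w \in Aset] `&` [set w | B (Xtail (t + tau) w)])
                 / (pr [set w | Xn t w \in Aset] * pr [set w | B (Xtail (t + tau) w)])
                 - 1 |)%:E ] ].

Definition psi_mixing : Prop := psi @ \oo --> 0%E.

Definition excess (d : A -> A -> R) (D : R) n (phi : word A n -> word A n) : R :=
  pr [set w | (dn d (Xn n w) (phi (Xn n w))) / n%:R > D].

Definition src_achievable (d : A -> A -> R) (D r : R) : Prop :=
  exists (e : forall n, word A n -> 'I_(msize r n)) (f : forall n, 'I_(msize r n) -> word A n),
    (fun n => excess d D (fun x => f n (e n x))) @ \oo --> 0.

Definition RP (d : A -> A -> R) (D : R) : \bar R :=
  ereal_inf [set r%:E | r in [set r : R | src_achievable d D r]].

Definition is_channel (c : forall n, word A n -> word A n -> R) : Prop :=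
  forall n (x : word A n), (forall y, 0 <= c n x y) /\ \sum_y c n x y = 1.

Definition directly_communicates (c : forall n, word A n -> word A n -> R)
   (d : A -> A -> R) (D : R) : Prop :=
  exists omega : nat -> R, (omega @ \oo --> 0) /\
    forall n, \sum_(x : word A n) \sum_(y : word A n)
        pr [set w | Xn n w = x] * c n x y * (if dn d x y / n%:R > D then 1 else 0)
      <= omega n.
End Defs.

(* channel coding: a random code is a probability distribution over
   deterministic encoder/decoder pairs (None = error symbol e) *)
Definition code_pair (A : finType) (M n : nat) : finType :=
  ({ffun 'I_M -> word A n} * {ffun word A n -> option 'I_M})%type.

Definition is_pmf (R : realType) (F : finType) (pi : F -> R) : Prop :=
  (forall p, 0 <= pi p) /\ \sum_p pi p = 1.

Definition code_err (R : realType) (A : finType) (c : forall n, word A n -> word A n -> R)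
   (M n : nat) (pi : code_pair A M n -> R) (m : 'I_M) : R :=
  \sum_(p : code_pair A M n) pi p *
    \sum_(y : word A n) c n (p.1 m) y * (if p.2 y == Some m then 0 else 1).

Definition reliably_achievable (R : realType) (A : finType)
   (c : forall n, word A n -> word A n -> R) (r : R) : Prop :=
  exists (pi : forall n, code_pair A (msize r n) n -> R) (delta : nat -> R),
    [/\ forall n, is_pmf (pi n), delta @ \oo --> 0 &
        forall n (m : 'I_(msize r n)), code_err c (pi n) m <= delta n].

(* Main.v *)
Require Import Defs.
From HB Require Import structures.
From mathcomp Require Import all_boot all_order all_algebra.
From mathcomp Require Import all_fingroup.
From mathcomp Require Import all_classical all_reals all_analysis.
From mathcomp Require Import zify ring lra.

(* Use a random codebook drawn from the law of X^n and decode y to the unique codeword that is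
   typical (its blocks of length k, separated by gaps of length tau, have empirical law close to
   that of X_1^k) and within distortion nD of y.  The error is at most the probability of excess
   distortion, plus that of atypicality, plus M times the largest probability of a set
   { x typical, d(x,y) <= nD }.  The point is that this probability is at most 2^(-nr) for every
   r < R^P_X(D) and n large.

   Suppose it is larger for some large n and some y.  By psi-mixing the blocks are independent up
   to a factor (1 + e)^m, and product laws are invariant under permutations of the blocks.  Hence
   for every long N the random block permutations of the l-fold repetition of y cover a whole type
   class of block sequences with about 2^(Nr) permutations.  Any typical source word is close in
   Hamming distance to that class, and the few remaining coordinates (mismatched blocks, gaps,
   remainders) are described losslessly at negligible rate; as d(x,x) = 0 this costs no distortion.
   So slightly more than r is achievable for the source, a contradiction. *)

Set Implicit Arguments. Unset Strict Implicit. Unset Printing Implicit Defensive.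
Import Order.TTheory GRing.Theory Num.Theory numFieldNormedType.Exports.
Local Open Scope ring_scope.

(** * Types and permutations *)


Section Counts.
Variables I B : finType.
Implicit Types (x t z : {ffun I -> B}) (s : {perm I}) (a : B).

Definition cnt z a : nat := #|[set i | z i == a]|.

Definition pact z s : {ffun I -> B} := [ffun i => z (s i)].

Lemma cnt_pact z s a : cnt (pact z s) a = cnt z a.
Proof.
rewrite /cnt -(card_imset [set i | pact z s i == a] (@perm_inj _ s)).
apply: eq_card => i; rewrite !inE; apply/imsetP/idP => [[j]|zi].
  by rewrite inE ffunE => zj ->.
by exists (s^-1%g i); rewrite ?inE ?ffunE permKV.
Qed.

Lemma pactM z s s' : pact (pact z s) s' = pact z (s' * s)%g.
Proof. by apply/ffunP => i; rewrite !ffunE permM. Qed.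

Lemma pact1 z : pact z 1%g = z.
Proof. by apply/ffunP => i; rewrite !ffunE perm1. Qed.

(* A permutation minimising the number of mismatches admits no improving transposition:
   no symbol occurs both as an unmatched value of [x] and as an unmatched value of [t]. *)
Lemma match_perm x t :
  exists s, (#|[set i | x i != t (s i)]| <= \sum_a (cnt x a - cnt t a))%N.
Proof.
pose M s := [set i | x i != t (s i)].
pose s := [arg min_(s < 1%g) #|M s|].
have smin s' : (#|M s| <= #|M s'|)%N.
  by rewrite /s; case: arg_minnP => //= s0 _; apply.
exists s; rewrite -/(M s).
have noswap i j : i \in M s -> j \in M s -> x i <> t (s j).
  rewrite !inE => Mi Mj xi.
  have ij : i != j by apply/eqP => e; move: Mi; rewrite xi -e eqxx.
  suff : (#|M (tperm i j * s)%g| < #|M s|)%N by rewrite ltnNge smin.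
  apply: proper_card; apply/properP; split.
    (* After the transposition position [i] carries the value [t (s j)], which equals [x i].
       Position [j] was mismatched before, so it cannot get worse. *)
    apply/fintype.subsetP => h; rewrite !inE permM.
    case: tpermP => [->|->|_ _ //]; first by rewrite xi eqxx.
    by [].
  by exists i; rewrite !inE // permM tpermL xi eqxx.
have -> : #|M s| = (\sum_a #|[set i in M s | x i == a]|)%N.
  rewrite -sum1_card (partition_big x predT) //=.
  by apply: eq_bigr => a _; rewrite -sum1_card; apply: eq_bigl => i; rewrite inE.
apply: leq_sum => a _.
case: (set_0Vmem [set i in M s | x i == a]) => [->|[i]]; first by rewrite cards0.
rewrite inE => /andP[Mi /eqP xi].
have eqx : cnt x a = (#|[set i in M s | x i == a]| + #|[set i in ~: M s | x i == a]|)%N.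
  rewrite /cnt -(cardsID (M s) [set i | x i == a]); congr (_ + _)%N.
    by apply: eq_card => j; rewrite !inE andbC.
  by apply: eq_card => j; rewrite !inE.
(* Since [a] is the value of [x] at the mismatch [i], [noswap] forces every occurrence of [a] in the
   rearranged [t] onto a matched position. The mismatches with value [a] are then exactly the
   surplus of [x] over [t]. *)
have eqt : cnt t a = #|[set i in ~: M s | x i == a]|.
  rewrite -(cnt_pact t s); apply: eq_card => j; rewrite !inE ffunE negbK.
  apply/eqP/andP => [tj|[/eqP-> //]]; last by move/eqP.
  suff /eqP-> : x j == t (s j) by rewrite tj.
  apply/negPn/negP => Mj; apply: (noswap i j) => //; first by rewrite inE.
  by rewrite xi tj.
by rewrite eqx eqt addnK.
Qed.

(** With equal types the mismatch bound of [match_perm] is zero, so a type class is a single orbit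
    under permutations. *)
Lemma cnt_eq_pact x t : cnt x =1 cnt t -> exists s, x = pact t s.
Proof.
move=> e; have [s] := match_perm x t.
rewrite big1 => [|a _]; last by rewrite e subnn.
rewrite leqn0 cards_eq0 => /eqP M0; exists s; apply/ffunP => i; rewrite ffunE.
by have /setP/(_ i) := M0; rewrite !inE => /negbFE/eqP.
Qed.

End Counts.

Section Weights.
Variables (R : realType) (I B : finType) (q : B -> R).
Hypotheses (q0 : forall a, 0 <= q a) (q1 : \sum_a q a = 1).
Implicit Types (x t z : {ffun I -> B}) (s : {perm I}) (G : {set {ffun I -> B}}).

Definition wt z : R := \prod_i q (z i).

Lemma wt_ge0 z : 0 <= wt z. Proof. exact: prodr_ge0. Qed.

Lemma wt_pact z s : wt (pact z s) = wt z.
Proof.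
rewrite /wt [RHS](reindex_inj (@perm_inj _ s)) /=.
by apply: eq_bigr => i _; rewrite ffunE.
Qed.

Lemma sum_wt : \sum_z wt z = 1.
Proof.
rewrite /wt -(bigA_distr_bigA (fun _ => q)) /=.
by rewrite big1.
Qed.

Lemma sum_wt_le1 G : \sum_(z in G) wt z <= 1.
Proof.
rewrite -sum_wt [leRHS](bigID (mem G)) /= lerDl sumr_ge0 // => z _.
exact: wt_ge0.
Qed.

(* A uniformly random rearrangement of [t] is uniform on the class of [t], on which [wt] is
   constant and has total mass at most 1. *)
Lemma perm_mass t G : (forall z, z \in G -> cnt z =1 cnt t) ->
  #|{perm I}|%:R * \sum_(z in G) wt z <= #|[set s | pact t s \in G]|%:R.
Proof.
move=> Gt; pose V : {set {ffun I -> B}} := [set z : {ffun I -> B} | [forall a, cnt z a == cnt t a]].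
have inV z : (z \in V) <-> cnt z =1 cnt t.
  by rewrite inE; split=> [/forallP e a|e]; [exact/eqP | apply/forallP => a; rewrite e].
(* The class is one orbit, so replacing [t] by another member only translates the set of
   permutations in the group. *)
have fV z : z \in V -> #|[set s | pact z s \in G]| = #|[set s | pact t s \in G]|.
  move=> /inV /cnt_eq_pact [r ->].
  rewrite -(card_imset [set s | pact (pact t r) s \in G] (@mulIg _ r)).
  apply: eq_card => s; rewrite !inE; apply/imsetP/idP => [[s']|sG].
    by rewrite inE pactM => ? ->.
  by exists (s * r^-1)%g; rewrite ?inE ?pactM mulgKV.
have -> : #|{perm I}|%:R * \sum_(z in G) wt z
          = \sum_(z in V) wt z * #|[set s | pact z s \in G]|%:R.
  (* Double counting of pairs [(s, z)]: for fixed [s] the inner sum is the mass of [G], as [wt] is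
     invariant; for fixed [z] it counts permutations. *)
  transitivity (\sum_(s : {perm I}) \sum_(z in V | pact z s \in G) wt z).
    rewrite -sum1_card natr_sum mulr_suml; apply: eq_bigr => s _; rewrite mul1r.
    have pinj : injective (fun z => pact z s^-1).
      by move=> z z' /(congr1 (fun z => pact z s)); rewrite !pactM mulgV !pact1.
    rewrite [RHS](reindex_inj pinj) /=.
    apply: eq_big => [z|z _]; last by rewrite wt_pact.
    rewrite pactM mulgV pact1; apply/idP/andP => [zG|[] //]; split=> //.
    by apply/inV => a; rewrite cnt_pact Gt.
  rewrite (exchange_big_dep (mem V)) => [|s z _ /andP[] //] /=.
  apply: eq_bigr => z zV; rewrite -sum1_card natr_sum mulr_sumr.
  by apply: eq_big => s; rewrite ?mulr1 // inE zV.
rewrite (eq_bigr (fun z => wt z * #|[set s | pact t s \in G]|%:R)) => [|z /fV -> //].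
by rewrite -mulr_suml ler_piMl // sum_wt_le1.
Qed.

End Weights.

(* Greedy choice: some column covers an [al] fraction of what is still uncovered. *)
Lemma greedy_cover (R : realType) (U S : finType) (rel : U -> S -> bool) (V : {set U}) (al : R) :
  al <= 1 -> (forall u, u \in V -> #|S|%:R * al <= #|[set s | rel u s]|%:R) ->
  (0 < #|S|)%N ->
  forall K, exists2 L : seq S, size L = K &
    #|[set u in V | ~~ has (rel u) L]|%:R <= #|V|%:R * (1 - al) ^+ K.
Proof.
move=> al1 cov S0; elim=> [|K [L sL IH]].
  by exists [::] => //; rewrite expr0 mulr1 ler_nat subset_leq_card //; apply/fintype.subsetP => u;
    rewrite inE => /andP[].
set W := [set u in V | ~~ has (rel u) L] in IH.
(* Averaging: if every column covered less than the fraction [al] of [W], then counting the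
   incidences by rows would give a contradiction. *)
have [s hs] : exists s, #|W|%:R * al <= #|[set u in W | rel u s]|%:R.
  apply: contrapT => /forallNP hs.
  have : \sum_(s : S) #|[set u in W | rel u s]|%:R < \sum_(s : S) #|W|%:R * al.
    have [s0 _] := card_gt0P S0.
    apply: ltr_sum => [|s _]; last by rewrite ltNge; apply/negP/hs.
    by apply/hasP; exists s0 => //; rewrite mem_index_enum.
  rewrite ltNge => /negP; apply.
  rewrite sumr_const -[leLHS]mulr_natl mulrCA.
  have -> : \sum_s #|[set u in W | rel u s]|%:R = \sum_(u in W) #|[set s | rel u s]|%:R :> R.
    rewrite (eq_bigr (fun s => \sum_(u in W | rel u s) 1)); last first.
      by move=> s _; rewrite -sum1_card natr_sum; apply: eq_bigl => u; rewrite inE.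
    rewrite (exchange_big_dep (mem W)) => [|s u _ /andP[] //] /=.
    apply: eq_bigr => u uW; rewrite -sum1_card natr_sum; apply: eq_bigl => s.
    by rewrite inE uW.
  rewrite -(sum1_card (mem W)) natr_sum mulr_suml; apply: ler_sum => u.
  by rewrite inE mul1r => /andP[uV _]; exact: cov.
exists (s :: L); first by rewrite /= sL.
have -> : [set u in V | ~~ has (rel u) (s :: L)] = W :\: [set u in W | rel u s].
  by apply/setP => u; rewrite !inE /= negb_or; case: (u \in V); case: (rel u s); case: has.
have sub : [set u in W | rel u s] \subset W by apply/fintype.subsetP => u; rewrite inE => /andP[].
rewrite cardsD (finset.setIidPr sub) natrB ?subset_leq_card //.
have : #|W|%:R * (1 - al) <= #|V|%:R * (1 - al) ^+ K.+1.
  by rewrite exprSr mulrA ler_wpM2r // subr_ge0.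
lra.
Qed.

Section TypicalCover.
Variables (R : realType) (I B : finType) (q : B -> R) (eta : R).
Hypotheses (q0 : forall a, 0 <= q a) (q1 : \sum_a q a = 1).
Implicit Types (x t z g : {ffun I -> B}) (s : {perm I}) (G : {set {ffun I -> B}}).

(** Strong typicality, with a tolerance uniform over the symbols instead of proportional to
    [q a]. *)
Definition typ z : bool :=
  [forall a, `|(cnt z a)%:R - #|I|%:R * q a| <= eta * #|I|%:R].

Lemma typ_match x t : typ x -> typ t ->
  exists s, #|[set i | x i != t (s i)]|%:R <= 2 * eta * #|B|%:R * #|I|%:R.
Proof.
move=> /forallP tx /forallP tt; have [s hs] := match_perm x t; exists s.
apply: (@le_trans _ _ (\sum_(a : B) 2 * eta * #|I|%:R)); last first.
  by rewrite sumr_const -[X in X <= _]mulr_natr mulrAC lexx.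
apply: le_trans (_ : (\sum_a (cnt x a - cnt t a))%:R <= _); first by rewrite ler_nat.
rewrite natr_sum; apply: ler_sum => a _.
have := tx a; have := tt a; rewrite !ler_norml => /andP[h1 h2] /andP[h3 h4].
have [le|lt] := leqP (cnt t a) (cnt x a); first by rewrite natrB //; lra.
by move/ltnW: lt; rewrite -subn_eq0 => /eqP->; lra.
Qed.

(** Pigeonhole over the polynomially many types finds a class carrying at least [al] divided by
    their number. Greedily chosen permutations carry every member of that class into [G], and every
    typical word agrees with some member of the class up to few mismatches. *)
Lemma typical_cover G (al : R) (K : nat) :
  (forall g, g \in G -> typ g) -> 0 < al -> al <= \sum_(g in G) wt q g ->
  #|I|%:R * #|B|%:R * (#|I|.+1%:R ^+ #|B|) < K%:R * al ->
  exists2 L : seq {perm I}, size L = K & forall z, typ z ->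
    exists2 s, s \in L & exists2 g, g \in G &
      #|[set i | z i != g (s i)]|%:R <= 2 * eta * #|B|%:R * #|I|%:R.
Proof.
move=> Gtyp al0 alG hK.
pose ty z : {ffun B -> 'I_(#|I|.+1)} := [ffun a => inord (cnt z a)].
have tyE z z' : ty z = ty z' -> cnt z =1 cnt z'.
  move=> /ffunP e a; have := e a; rewrite !ffunE => /(congr1 val) /=.
  by rewrite !inordK // ltnS max_card.
set N := #|I|.+1%:R ^+ #|B| in hK.
have N0 : 0 < N by rewrite exprn_gt0 // ltr0n.
pose al' := al / N.
have al'0 : 0 < al' by rewrite divr_gt0.
have [v hv] : exists v, al' <= \sum_(g in G | ty g == v) wt q g.
  apply: contrapT => /forallNP hs.
  have : \sum_(v : {ffun B -> 'I_(#|I|.+1)}) \sum_(g in G | ty g == v) wt q g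
         < \sum_(v : {ffun B -> 'I_(#|I|.+1)}) al'.
    apply: ltr_sum => [|s _]; last by rewrite ltNge; apply/negP/hs.
    by apply/hasP; exists [ffun=> ord0] => //; rewrite mem_index_enum.
  rewrite -(partition_big ty predT) //= sumr_const card_ffun card_ord ltNge => /negP; apply.
  by rewrite -mulr_natr natrX /al' divfK ?gt_eqF.
pose Gv := [set g in G | ty g == v].
have {}hv : al' <= \sum_(g in Gv) wt q g.
  by apply: le_trans hv _; rewrite le_eqVlt; apply/orP; left; apply/eqP; apply: eq_bigl => g; rewrite inE.
have [t tGv] : exists t, t \in Gv.
  apply/set0Pn/eqP => G0; move: hv; rewrite G0 big_set0 => /(lt_le_trans al'0).
  by rewrite ltxx.
have Gvt z : z \in Gv -> cnt z =1 cnt t.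
  move: tGv; rewrite !inE => /andP[_ /eqP tv] /andP[_ /eqP zv].
  by apply: tyE; rewrite zv tv.
pose V : {set {ffun I -> B}} := [set z : {ffun I -> B} | [forall a, cnt z a == cnt t a]].
have inV z : (z \in V) <-> cnt z =1 cnt t.
  by rewrite inE; split=> [/forallP e a|e]; [exact/eqP | apply/forallP => a; rewrite e].
have [|||L sL cov] := @greedy_cover R _ _ (fun z s => pact z s \in Gv) V al' _ _ _ K.
- exact: le_trans hv (sum_wt_le1 _ _ _).
- move=> z /inV zt; apply: le_trans (perm_mass _ _ _) => //.
    by rewrite ler_wpM2l ?ler0n.
  by move=> g /Gvt gt a; rewrite gt zt.
- by apply/card_gt0P; exists 1%g.
(* The greedy cover moves a word of the class into [G], whereas the conclusion moves an element of
   [G] back; hence the inverses. *)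
exists [seq (s^-1)%g | s <- L]; first by rewrite size_map.
move=> z tz.
have tt : typ t by apply: Gtyp; move: tGv; rewrite inE => /andP[].
have [s hs] := typ_match tz tt.
have : pact t s \in V by apply/inV => a; rewrite cnt_pact.
have : #|[set u in V | ~~ has (fun s => pact u s \in Gv) L]|%:R < 1 :> R.
  apply: le_lt_trans cov _.
  have al'1 : al' <= 1 by exact: le_trans hv (sum_wt_le1 _ _ _).
  (* The number of uncovered words is an integer below 1. The crude bound of [#|B|] by [expR #|B|]
     suffices, since it costs only a factor [#|I| * #|B|] in [K]. *)
  apply: le_lt_trans (_ : expR (#|I|%:R * #|B|%:R) * expR (- al' * K%:R) < 1).
    apply: ler_pM; rewrite ?ler0n ?exprn_ge0 ?subr_ge0 //.
      apply: le_trans (_ : (#|B|%:R ^+ #|I|) <= _).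
        rewrite -natrX -card_ffun ler_nat; exact: max_card.
      rewrite expRM_natl lerXn2r ?nnegrE ?ler0n ?expR_ge0 //.
      by apply: le_trans (expR_ge1Dx _); rewrite lerDr.
    rewrite expRM_natr lerXn2r ?nnegrE ?subr_ge0 ?expR_ge0 //.
    exact: expR_ge1Dx.
  rewrite -expRD expR_lt1 mulNr subr_lt0 /al' mulrAC ltr_pdivlMr //.
  by rewrite (mulrC al).
rewrite ltrn1 ltnS leqn0 cards_eq0 => /eqP/setP/(_ (pact t s)); rewrite finset.in_set0 inE => e tV.
move: e; rewrite tV /= => /negbFE /hasP[s' s'L]; rewrite inE => /andP[gG _].
exists (s'^-1)%g; first by rewrite map_f.
exists (pact (pact t s) s') => //; apply: le_trans hs; rewrite ler_nat subset_leq_card //.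
by apply/fintype.subsetP => i; rewrite !inE !ffunE permKV.
Qed.
End TypicalCover.


(** * Repetitions of a set of block sequences *)

Section Powers.
Variables (R : realType) (J B : finType) (q : B -> R) (l : nat).

Definition part (g : {ffun 'I_l * J -> B}) (j : 'I_l) : {ffun J -> B} := [ffun i => g (j, i)].

Definition setpow (G : {set {ffun J -> B}}) : {set {ffun 'I_l * J -> B}} :=
  [set g | [forall j, part g j \in G]].

(** The [l] parts are independent under the product weight. This makes the mass of the repeated set
    decay at the same exponential rate as that of [G]. *)
Lemma wt_setpow (G : {set {ffun J -> B}}) : \sum_(g in setpow G) wt q g = (\sum_(z in G) wt q z) ^+ l.
Proof.
rewrite [\sum_(z in G) _]big_mkcond /= -[X in _ ^+ X]card_ord -prodr_const.
rewrite (bigA_distr_bigA (fun (_ : 'I_l) z => if z \in G then wt q z else 0)) /= big_mkcond.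
pose u (f : {ffun 'I_l -> {ffun J -> B}}) : {ffun 'I_l * J -> B} := [ffun p => f p.1 p.2].
have partu f j : part (u f) j = f j by apply/ffunP => i; rewrite !ffunE.
rewrite (reindex u) /=; last first.
  exists (fun g => [ffun j => part g j]) => [f|g] _; apply/ffunP.
    by move=> j; rewrite ffunE partu.
  by move=> [j i]; rewrite !ffunE.
apply: eq_bigr => f _; case: ifP => [|/negbT].
  rewrite inE => /forallP fG; transitivity (\prod_(j < l) wt q (f j)); last first.
    by apply: eq_bigr => j _; have := fG j; rewrite partu => ->.
  by rewrite /wt pair_bigA; apply: eq_bigr => p _; rewrite ffunE.
rewrite inE negb_forall => /existsP[j]; rewrite partu => fj.
by rewrite (bigD1 j) //= (negbTE fj) mul0r.
Qed.

(** Counts, their expected values and the tolerances all add up over the parts, so [eta] does not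
    deteriorate. *)
Lemma typ_setpow (eta : R) (G : {set {ffun J -> B}}) : (forall z, z \in G -> typ q eta z) ->
  forall g, g \in setpow G -> typ q eta g.
Proof.
move=> Gt g; rewrite inE => /forallP gG; apply/forallP => a.
have -> : cnt g a = (\sum_(j < l) cnt (part g j) a)%N.
  rewrite /cnt -sum1_card; under [RHS]eq_bigr do rewrite -sum1_card.
  rewrite pair_big_dep /=; apply: eq_bigl => -[j i] /=.
  by rewrite !inE ffunE.
rewrite card_prod card_ord natrM.
have -> : l%:R * #|J|%:R * q a = \sum_(j < l) #|J|%:R * q a.
  by rewrite sumr_const card_ord -[RHS]mulr_natl mulrA.
have -> : eta * (l%:R * #|J|%:R) = \sum_(j < l) eta * #|J|%:R.
  by rewrite sumr_const card_ord -[RHS]mulr_natl mulrCA.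
rewrite natr_sum -sumrB; apply: le_trans (ler_norm_sum _ _ _) _.
by apply: ler_sum => j _; have /Gt/forallP/(_ a) := gG j.
Qed.

End Powers.

(** * Sparse corrections *)


Section Overrides.
Variables (R : realType) (A : finType).

(** An override [z] keeps a base word where it is [None] and imposes the letter [a] where it is
    [Some a]. *)
Definition nsupp N (z : {ffun 'I_N -> option A}) : nat := #|[set i | z i != None]|.

Definition sparse (be : R) N : {set {ffun 'I_N -> option A}} :=
  [set z | (nsupp z)%:R <= be * N%:R].

(* Weigh each override by [theta ^ nsupp]: the total weight is [(1 + #|A| theta) ^ N]. *)
Lemma sparse_count (ka : R) : 0 < ka ->
  exists2 be : R, 0 < be & forall N, #|sparse be N|%:R <= expR (ka * N%:R).
Proof.
move=> ka0; pose th : R := Num.min 1 (ka / 2 / #|A|.+1%:R).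
have th0 : 0 < th by rewrite lt_min ltr01 !divr_gt0 // ltr0n.
have th1 : th <= 1 by rewrite ge_min lexx.
have thA : #|A|%:R * th <= ka / 2.
  have A0 : 0 < #|A|.+1%:R :> R by rewrite ltr0n.
  apply: le_trans (_ : #|A|.+1%:R * th <= _).
    by rewrite ler_wpM2r ?ler_nat // ltW.
  by rewrite mulrC -ler_pdivlMr // ge_min lexx orbT.
pose L := - ln th.
have L0 : 0 <= L by rewrite oppr_ge0 ln_le0.
have thE : th = expR (- L) by rewrite opprK lnK.
(* Chosen so that a sparse override weighs at least [expR (- (ka / 2 * N))], while the total weight
   is at most [expR (ka / 2 * N)]. The added 1 covers [L = 0], that is [th = 1]. *)
exists (ka / 2 / (L + 1)); first by rewrite !divr_gt0 // ltr_wpDl.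
set be := _ / (L + 1) => N.
have beL : be * L <= ka / 2.
  rewrite /be mulrAC ler_pdivrMr ?ltr_wpDl //.
  by rewrite ler_wpM2l // ?lerDl // ltW // divr_gt0.
have wE (z : {ffun 'I_N -> option A}) : th ^+ nsupp z = \prod_i (if z i == None then 1 else th).
  rewrite /nsupp -prodr_const big_mkcond /=.
  by apply: eq_bigr => i _; rewrite inE; case: (z i).
have sumw : \sum_(o : option A) (if o == None then 1 else th) = 1 + #|A|%:R * th.
  rewrite (bigD1 None) //= (eq_bigr (fun=> th)) => [|o /negbTE-> //].
  by rewrite sumr_const cardC1 card_option mulr_natl.
have tot : \sum_(z : {ffun 'I_N -> option A}) th ^+ nsupp z <= expR (ka / 2 * N%:R).
  under eq_bigr do rewrite wE.
  rewrite -(bigA_distr_bigA (fun (_ : 'I_N) (o : option A) => if o == None then 1 else th)) /=.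
  rewrite sumw prodr_const card_ord expRM_natr lerXn2r ?nnegrE ?expR_ge0 //.
    by rewrite addr_ge0 // mulr_ge0 ?ler0n // ltW.
  by apply: le_trans (expR_ge1Dx _) _; rewrite ler_expR.
have low (z : {ffun 'I_N -> option A}) : z \in sparse be N -> expR (- (ka / 2 * N%:R)) <= th ^+ nsupp z.
  rewrite inE => hz; rewrite thE -expRM_natr ler_expR mulNr lerN2.
  apply: le_trans (_ : L * (be * N%:R) <= _); first by rewrite ler_wpM2l.
  by rewrite mulrA (mulrC L) ler_wpM2r ?ler0n.
have : #|sparse be N|%:R * expR (- (ka / 2 * N%:R)) <= expR (ka / 2 * N%:R).
  apply: le_trans tot; rewrite [leRHS](bigID (mem (sparse be N))) /=.
  rewrite -[leLHS]addr0 lerD ?sumr_ge0 // => [|z _]; last by rewrite exprn_ge0 // ltW.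
  rewrite mulr_natl -sumr_const; exact: ler_sum.
rewrite -ler_pdivlMr ?expR_gt0 // -expRN opprK -expRD -mulrDl.
by rewrite -splitr.
Qed.

End Overrides.

(** * Reproduction words from rearranged patterns *)

Section SourceWords.
Variables (R : realType) (A I : finType) (k N : nat) (d : A -> A -> R).
Variables (pos : I * 'I_k -> 'I_N).
Hypotheses (pos_inj : injective pos) (d0 : forall x y, 0 <= d x y) (dxx : forall x, d x x = 0).

Definition zblk (x : word A N) : {ffun I -> word A k} :=
  [ffun i => [ffun h => x (pos (i, h))]].

(* The reproduction words rearrange the pattern [y] by the permutations in [L], and are then
   corrected losslessly at few times: outside the blocks, and in the mismatched blocks. *)
Lemma source_words (q : word A k -> R) (eta be De : R) (G : {set {ffun I -> word A k}})
    (L : seq {perm I}) (y : I -> word A k) (a0 : A) :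
  (forall g, g \in G -> \sum_i dn d (g i) (y i) <= De) ->
  (forall z, typ q eta z -> exists2 s, s \in L & exists2 g, g \in G &
      #|[set i | z i != g (s i)]|%:R <= 2 * eta * #|word A k|%:R * #|I|%:R) ->
  N%:R - k%:R * #|I|%:R + k%:R * (2 * eta * #|word A k|%:R * #|I|%:R) <= be * N%:R ->
  exists2 C : {set word A N}, (#|C| <= size L * #|sparse A be N|)%N &
    forall x, typ q eta (zblk x) -> exists2 w, w \in C & dn d x w <= De.
Proof.
move=> Gd Lcov Nbe.
(* The rearranged pattern, read at letter positions. Off the blocks it takes the default [a0], which
   the override chosen below replaces. *)
pose base (s : {perm I}) (t : 'I_N) : A :=
  if [pick p | pos p == t] is Some p then y (s p.1) p.2 else a0.
have baseE s p : base s (pos p) = y (s p.1) p.2.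
  rewrite /base; case: pickP => [p' /eqP/pos_inj -> //|/(_ p)].
  by rewrite eqxx.
pose ov (s : {perm I}) (z : {ffun 'I_N -> option A}) : word A N :=
  [ffun t => odflt (base s t) (z t)].
exists [set ov sz.1 sz.2 | sz in [set sz | (sz.1 \in L) && (sz.2 \in sparse A be N)]].
  apply: leq_trans (leq_imset_card _ _) _.
  have -> : [set sz | (sz.1 \in L) && (sz.2 \in sparse A be N)] = finset.setX [set s in L] (sparse A be N).
    by apply/setP => -[s z]; rewrite !inE.
  by rewrite cardsX leq_mul2r (cardsE (mem L)) card_size orbT.
move=> x /Lcov[s sL [g gG hs]].
pose Ok := [set p : I * 'I_k | zblk x p.1 == g (s p.1)].
(* Only fully matched blocks keep the base word; everywhere else [x] itself is written, at zero
   distortion. *)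
pose z := [ffun t => if t \in [set pos p | p in Ok] then None else Some (x t)].
have zsp : z \in sparse A be N.
  rewrite inE; apply: le_trans Nbe.
  have nz : nsupp z = (N - #|Ok|)%N.
    rewrite -(card_imset (mem Ok) pos_inj) -[X in (X - _)%N]card_ord.
    rewrite -[in RHS](finset.setCK [set pos p | p in Ok]) -cardsCs.
    by apply: eq_card => t; rewrite !inE ffunE; case: ifP.
  have OkN : (#|Ok| <= N)%N.
    by rewrite -(card_imset (mem Ok) pos_inj) -[leqRHS]card_ord max_card.
  have OkE : Ok = finset.setX [set i | zblk x i == g (s i)] [set: 'I_k].
    by apply/setP => -[i h]; rewrite !inE andbT.
  rewrite nz natrB // OkE cardsX cardsT card_ord natrM.
  have : #|[set i | zblk x i == g (s i)]|%:R = #|I|%:R - #|[set i | zblk x i != g (s i)]|%:R :> R.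
    rewrite -natrB ?max_card //; congr (_%:R); rewrite cardsCs; congr (_ - _)%N.
    by apply: eq_card => i; rewrite !inE.
  move=> ->; rewrite mulrC mulrBr opprB addrCA addrC.
  by rewrite lerD2l ler_wpM2l ?ler0n.
exists (ov s z); first by apply/imsetP; exists (s, z) => //; rewrite inE sL zsp.
rewrite /dn (bigID (mem [set pos p | p in Ok])) /= [X in _ + X]big1 ?addr0; last first.
  by move=> t /negbTE tn; rewrite !ffunE tn dxx.
rewrite big_imset /=; last by move=> p p' _ _; exact: pos_inj.
(* On a matched block [i] the source shows [g (s i)] and the base shows [y (s i)]. After reindexing
   by [s] these terms are part of the distortion between [g] and [y]. *)
apply: le_trans (Gd _ gG); rewrite [leRHS](reindex_inj (@perm_inj _ s)) /=.
rewrite /dn pair_big /= [leRHS](bigID (mem Ok)) /= -[leLHS]addr0 lerD ?sumr_ge0 //.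
apply: ler_sum => p; rewrite inE => /eqP pOk.
rewrite !ffunE imset_f ?inE ?pOk //= baseE -pOk !ffunE.
by case: p {pOk}.
Qed.

End SourceWords.

(** * Probabilities of finitely determined events *)


Section Events.
Variables (R : realType) (d0 : measure_display) (T : measurableType d0) (P : probability T R).
Local Open Scope classical_set_scope.
Implicit Types (E : set T).

Definition fmeas (F : finType) (g : T -> F) : Prop :=
  forall f, measurable (g @^-1` [set f]).

Lemma pr_ge0 E : 0 <= pr P E. Proof. exact: fine_ge0. Qed.

Lemma prE E : measurable E -> (pr P E)%:E = P E.
Proof. by move=> mE; rewrite fineK // fin_num_measure. Qed.

Lemma pr_le1 E : measurable E -> pr P E <= 1.
Proof. by move=> mE; rewrite -lee_fin prE // probability_le1. Qed.

Lemma le_pr E E' : measurable E -> measurable E' -> E `<=` E' -> pr P E <= pr P E'.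
Proof. by move=> mE mE' sE; rewrite -lee_fin !prE // le_measure ?inE. Qed.

Lemma fmeas_mem (F : finType) (g : T -> F) : fmeas g ->
  forall s : seq F, measurable [set w | g w \in s].
Proof.
move=> mg; elim=> [|f s IH].
  by rewrite (_ : [set w | _] = set0) //; apply/seteqP; split.
rewrite (_ : [set w | _] = g @^-1` [set f] `|` [set w | g w \in s]).
  exact: measurableU.
apply/seteqP; split=> w /=; rewrite in_cons.
  by case/orP => [/eqP|]; [left | right].
by case=> [->|->]; rewrite ?eqxx ?orbT.
Qed.

Lemma fmeas_pred (F : finType) (g : T -> F) (h : pred F) : fmeas g ->
  measurable [set w | h (g w)].
Proof.
move=> /fmeas_mem /(_ (enum h)); congr measurable; apply/seteqP.
by split=> w /=; rewrite mem_enum.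
Qed.

Lemma pr_fin (F : finType) (g : T -> F) (h : pred F) : fmeas g ->
  pr P [set w | h (g w)] = \sum_(f | h f) pr P [set w | g w = f].
Proof.
move=> mg.
have mem s : uniq s -> pr P [set w | g w \in s] = \sum_(f <- s) pr P [set w | g w = f].
  elim: s => [_|f s IH /= /andP[fs us]].
    rewrite big_nil (_ : [set w | _] = set0) ?/pr ?measure0 //.
    by apply/seteqP; split.
  rewrite big_cons -(IH us) (_ : [set w | _] = [set w | g w = f] `|` [set w | g w \in s]); last first.
    apply/seteqP; split=> w /=; rewrite in_cons.
      by case/orP => [/eqP|]; [left | right].
    by case=> [->|->]; rewrite ?eqxx ?orbT.
  have ms := fmeas_mem mg s; have mf := mg f.
  apply: EFin_inj; rewrite EFinD !prE ?measureU //; last exact: measurableU.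
  by apply/seteqP; split=> w //= -[->]; rewrite (negbTE fs).
rewrite -big_enum /= -(mem _ (enum_uniq h)); congr pr.
by apply/seteqP; split=> w /=; rewrite mem_enum.
Qed.

Lemma fmeas_ffun (I F : finType) (g : I -> T -> F) :
  (forall i, fmeas (g i)) -> fmeas (fun w => [ffun i => g i w]).
Proof.
move=> mg f.
rewrite (_ : _ @^-1` _ = \bigcap_(i in [set: I]) (g i @^-1` [set f i])).
  by apply: fin_bigcap_measurable => // i _; exact: mg.
apply/seteqP; split=> w /= h.
  by move=> i _ /=; rewrite -h ffunE.
by apply/ffunP => i; rewrite ffunE; apply: h.
Qed.

Lemma sum_law (F : finType) (g : T -> F) : fmeas g -> \sum_f pr P [set w | g w = f] = 1.
Proof.
move=> mg; rewrite -(pr_fin predT mg) /pr (_ : [set w | _] = setT) ?probability_setT //.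
by apply/seteqP; split.
Qed.

End Events.

(** * Mixing and the law of large numbers for blocks *)


Section Process.
Variables (R : realType) (A : finType).
Variables (d0 : measure_display) (T : measurableType d0) (P : probability T R) (X : nat -> T -> A).
Hypotheses (hX : process X) (hS : stationary P X).
Local Open Scope classical_set_scope.

Definition wblk k s (w : T) : word A k := [ffun h : 'I_k => X (s + h)%N w].

Lemma fmeas_wblk k s : fmeas (wblk k s).
Proof. by apply: fmeas_ffun => h; exact: hX. Qed.

Lemma fmeas_Xn n : fmeas (Xn X n).
Proof. by apply: fmeas_ffun => h; exact: hX. Qed.

Definition block_cyl k s (a : word A k) : set (nat -> A) := [set f | forall h : 'I_k, f (s + h)%N = a h].

Lemma block_cyl_measurable k s a : prod_measurable (@block_cyl k s a).
Proof.
(* One coordinate at a time, indexed by all of [nat] so that the intersection becomes the complement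
   of a countable union; for [n >= k] the condition is vacuous. *)
pose C n : set (nat -> A) := [set f | forall h : 'I_k, h = n :> nat -> f (s + h)%N = a h].
have mC n : <<s @cyl A >> (C n).
  have [nk|kn] := ltnP n k.
    apply: sub_sigma_algebra; exists (s + n)%N, (a (Ordinal nk)).
    apply/seteqP; split=> f /= hf; first exact: (hf (Ordinal nk)).
    by move=> h hn; rewrite (_ : h = Ordinal nk) //; exact: val_inj.
  rewrite (_ : C n = setT `\` set0); first by apply: sigma_algebraCD; apply: sigma_algebra0.
  apply/seteqP; split=> f; first by move=> _; split.
  move=> _ h hn.
  by have := ltn_ord h; rewrite hn ltnNge kn.
have : <<s @cyl A >> (setT `\` \bigcup_n (setT `\` C n)).
  by apply: sigma_algebraCD; apply: sigma_algebra_bigcup => n; apply: sigma_algebraCD.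
congr (_ _); apply/seteqP; split=> f /=.
  case=> _ hf h; apply: contrapT => fh; apply: hf; exists (nat_of_ord h) => //; split=> // /(_ h erefl).
  exact: fh.
by move=> hf; split=> // -[n _ [_]]; apply=> h _; exact: hf.
Qed.

Lemma block_cylE k s t a : [set w | @block_cyl k s a (Xtail X t w)] = [set w | wblk k (t + s) w = a].
Proof.
apply/seteqP; split=> w /=.
  by move=> h; apply/ffunP => i; rewrite ffunE -h /Xtail addnA.
by move=> <- h; rewrite /Xtail ffunE addnA.
Qed.

Lemma blk_law k s a : pr P [set w | wblk k s w = a] = pr P [set w | wblk k 0 w = a].
Proof.
elim: s => // s <-; rewrite /pr; congr fine.
by have := hS (@block_cyl_measurable k s a); rewrite !block_cylE add0n add1n => ->.
Qed.

(** The mixing ratio is at most [1 + e]; null events are treated apart because [psi] excludes them.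
    A gap longer than [tau] is allowed by placing the cylinder deeper in the tail. *)
Lemma psi_upper tau (e : R) t (S : {set word A t}) k s (a : word A k) :
  (psi P X tau <= e%:E)%E -> 0 <= e -> (0 < t)%N -> (t + tau <= s)%N ->
  pr P [set w | (Xn X t w \in S) && (wblk k s w == a)]
    <= (1 + e) * pr P [set w | Xn X t w \in S] * pr P [set w | wblk k 0 w = a].
Proof.
move=> he e0 t0 hs; rewrite -(blk_law s a).
have mS := fmeas_mem (@fmeas_Xn t) (enum S).
have {}mS : measurable [set w | Xn X t w \in S].
  by move: mS; congr measurable; apply/seteqP; split=> w /=; rewrite mem_enum.
have ma : measurable [set w | wblk k s w = a] by exact: fmeas_wblk.
have -> : [set w | (Xn X t w \in S) && (wblk k s w == a)]
   = [set w | Xn X t w \in S] `&` [set w | wblk k s w = a].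
  by apply/seteqP; split=> w /= => [/andP[-> /eqP ->]|[-> ->]] //; rewrite eqxx.
have mI := measurableI _ _ mS ma.
have [|a1] := leP (pr P [set w | Xn X t w \in S]) 0.
  move=> z; have z0 : pr P [set w | Xn X t w \in S] = 0 by apply/eqP; rewrite eq_le z pr_ge0.
  by rewrite z0 mulr0 mul0r -z0 le_pr //; exact: subIsetl.
have [|a2] := leP (pr P [set w | wblk k s w = a]) 0.
  move=> z; have z0 : pr P [set w | wblk k s w = a] = 0 by apply/eqP; rewrite eq_le z pr_ge0.
  by rewrite z0 mulr0 -z0 le_pr //; exact: subIsetr.
have es : s = (t + tau + (s - (t + tau)))%N by rewrite subnKC.
have : (`| pr P ([set w | Xn X t w \in S] `&` [set w | wblk k s w = a])
         / (pr P [set w | Xn X t w \in S] * pr P [set w | wblk k s w = a]) - 1 |%:E <= e%:E)%E.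
  apply: le_trans he; apply: ereal_sup_ubound; exists t, S, (@block_cyl k (s - (t + tau)) a).
  by rewrite block_cylE -es; split=> //; exact: block_cyl_measurable.
rewrite lee_fin ler_norml => /andP[_]; rewrite lerBlDr ler_pdivrMr ?mulr_gt0 //.
by rewrite mulrA (addrC e).
Qed.

Section Mix.
Variables (k u tau : nat) (e : R).
Hypotheses (k0 : (0 < k)%N) (uE : (u = k + tau)%N) (e0 : 0 <= e) (he : (psi P X tau <= e%:E)%E).

Definition law (a : word A k) : R := pr P [set w | wblk k 0 w = a].

(** The blocks are split off from the last one backwards, each at the cost of one mixing factor
    [1 + e]. *)
Lemma blocks_upper m (z : nat -> word A k) :
  pr P [set w | [forall i : 'I_m, wblk k (i * u) w == z i]]
    <= (1 + e) ^+ m * \prod_(i < m) law (z i).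
Proof.
elim: m => [|m IH].
  rewrite big_ord0 expr0 mulr1; apply: pr_le1.
  rewrite (_ : [set w | _] = setT) //; apply/seteqP; split => // w _ /=.
  by apply/forallP => -[].
rewrite big_ord_recr /= exprSr.
(* A single block has no past, and [psi] only speaks of pasts of positive length. *)
have [->|m0] := posnP m.
  rewrite expr0 big_ord0 !mul1r; apply: le_trans (_ : law (z 0%N) <= _); last first.
    by rewrite ler_peMl ?lerDl // pr_ge0.
  apply: le_pr; [|exact: fmeas_wblk|].
    have := fmeas_pred (fun v : {ffun 'I_1 -> word A k} => [forall i, v i == z i])
      (fmeas_ffun (fun i : 'I_1 => @fmeas_wblk k (i * u)%N)).
    by congr measurable; apply/seteqP; split=> w /= /forallP h; apply/forallP => i; have := h i; rewrite ffunE.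
  by move=> w /= /forallP /(_ ord0) /eqP; rewrite mul0n.
(* The past stops at the end of block [m - 1], exactly [tau] letters before block [m] starts. *)
pose t := (m.-1 * u + k)%N.
pose S : {set word A t} := finset (fun x : word A t =>
  [forall i : 'I_m, [forall h : 'I_k,
   [forall o : 'I_t, (o == (i * u + h)%N :> nat) ==> (x o == z i h)]]]).
have SE w : (Xn X t w \in S) = [forall i : 'I_m, wblk k (i * u) w == z i].
  rewrite inE; apply: eq_forallb => i; apply/forallP/eqP => h.
    apply/ffunP => j; rewrite ffunE.
    have lt : (i * u + j < t)%N.
      rewrite /t; have := ltn_ord i; have := ltn_ord j.
      move: (i : nat) (j : nat) => i' j'; clear; move=> hj hi.
      have : (i' * u <= m.-1 * u)%N by rewrite leq_mul2r; apply/orP; right; lia.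
      lia.
    by have /forallP/(_ (Ordinal lt)) := h j; rewrite /= eqxx ffunE /= => /eqP.
  by move=> j; apply/forallP => o; apply/implyP => /eqP oE; rewrite ffunE oE -h ffunE.
have -> : [set w | [forall i : 'I_m.+1, wblk k (i * u) w == z i]]
   = [set w | (Xn X t w \in S) && (wblk k (m * u) w == z m)].
  apply/seteqP; split=> w /=; rewrite SE.
    move=> /forallP h; apply/andP; split; last exact: (h ord_max).
    by apply/forallP => i; exact: (h (widen_ord (leqnSn m) i)).
  move=> /andP[/forallP h hm]; apply/forallP => i.
  have [lt|] := ltnP i m; first exact: (h (Ordinal lt)).
  by have := ltn_ord i; rewrite ltnS => le1 le2; rewrite (_ : val i = m) //; apply/eqP; rewrite eqn_leq le1.
apply: le_trans (@psi_upper tau e t S k (m * u) (z m) he e0 _ _) _.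
- by rewrite /t addn_gt0 k0 orbT.
- by rewrite /t -addnA -uE -{2}(prednK m0) mulSn addnC.
rewrite mulrA ler_wpM2r ?pr_ge0 // [leRHS]mulrAC [leRHS]mulrC ler_wpM2l ?addr_ge0 //.
by apply: le_trans IH; under eq_set do rewrite SE.
Qed.

End Mix.


Section LLN.
Variables (k u : nat) (I : finType) (pos : I -> nat).
Hypotheses (k0 : (0 < k)%N) (ku : (k <= u)%N) (pos_inj : injective pos).

Definition blks (w : T) : {ffun I -> word A k} := [ffun i => wblk k (pos i * u) w].

Lemma fmeas_blks : fmeas blks.
Proof. by apply: fmeas_ffun => i; exact: fmeas_wblk. Qed.

Lemma law_le1 (a : word A k) : law a <= 1.
Proof. by apply: pr_le1; exact: fmeas_wblk. Qed.

Variables (J : nat) (e : R).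
Hypotheses (e0 : 0 <= e) (he : (psi P X J <= e%:E)%E).

(** Here [J] counts slots of length [u] as well as letters of mixing gap: more than [J] slots of
    distance leave at least [J] letters between the two blocks. *)
Lemma pair_far i j (a : word A k) : (pos i + J < pos j)%N ->
  pr P [set w | (blks w i == a) && (blks w j == a)] <= (1 + e) * law a * law a.
Proof.
move=> far; pose t := (pos i * u + k)%N.
pose S : {set word A t} := finset (fun x : word A t => [forall h : 'I_k,
   [forall o : 'I_t, (o == (pos i * u + h)%N :> nat) ==> (x o == a h)]]).
have SE w : (Xn X t w \in S) = (wblk k (pos i * u) w == a).
  rewrite inE; apply/forallP/eqP => h.
    apply/ffunP => j'; rewrite ffunE.
    have lt : (pos i * u + j' < t)%N by rewrite ltn_add2l.
    by have /forallP/(_ (Ordinal lt)) := h j'; rewrite /= eqxx ffunE /= => /eqP.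
  by move=> j'; apply/forallP => o; apply/implyP => /eqP oE; rewrite ffunE oE -h ffunE.
have lS : law a = pr P [set w | Xn X t w \in S].
  rewrite /law -(blk_law (pos i * u)); congr pr.
  by apply/seteqP; split=> w /=; rewrite SE => /eqP.
have -> : [set w | (blks w i == a) && (blks w j == a)]
    = [set w | (Xn X t w \in S) && (wblk k (pos j * u) w == a)].
  by apply/seteqP; split=> w /=; rewrite SE !ffunE.
rewrite [X in _ * X * _]lS; apply: (@psi_upper J) => //; first by rewrite addn_gt0 k0 orbT.
apply: leq_trans (_ : (pos i + J.+1) * u <= _)%N; last by rewrite leq_mul2r addnS far orbT.
rewrite mulnDl -addnA leq_add2l mulSn leq_add // leq_pmulr //.
exact: leq_trans k0 ku.
Qed.

(** Far pairs are nearly uncorrelated from above; near pairs get the trivial bound 1, paid for by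
    the indicator. *)
Lemma pair_any i j (a : word A k) :
  pr P [set w | (blks w i == a) && (blks w j == a)]
    <= law a ^+ 2 + e + ((pos i <= pos j + J)%N && (pos j <= pos i + J)%N)%:R.
Proof.
have q0 : 0 <= law a by exact: pr_ge0.
have q1 := law_le1 a.
have q2 : law a ^+ 2 <= 1 by rewrite expr_le1.
have e2 : e * law a ^+ 2 <= e by rewrite ler_piMr.
have far : (1 + e) * law a * law a <= law a ^+ 2 + e.
  by rewrite -mulrA -expr2 mulrDl mul1r lerD2l.
have [ij|ji] := leqP (pos i) (pos j + J); last first.
  rewrite addr0; apply: le_trans far; apply: le_trans (@pair_far j i a ji).
  by rewrite le_eqVlt; apply/orP; left; apply/eqP; congr pr; apply/seteqP; split=> w /=; rewrite andbC.
have [_|lt] := leqP (pos j) (pos i + J); last first.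
  by rewrite addr0; apply: le_trans far; exact: pair_far.
apply: le_trans (_ : 1 <= _); last by rewrite lerDr addr_ge0 // exprn_ge0.
apply: pr_le1; exact: (fmeas_pred (fun f : {ffun I -> word A k} => (f i == a) && (f j == a)) fmeas_blks).
Qed.

Lemma near_count i : (#|finset (fun j => (pos i <= pos j + J)%N && (pos j <= pos i + J)%N)| <= (2 * J).+1)%N.
Proof.
set S := finset _.
rewrite -(card_ord (2 * J).+1).
pose f j : 'I_(2 * J).+1 := inord (pos j + J - pos i).
have finj : {in S &, injective f}.
  move=> j j'; rewrite !inE => /andP[h1 h2] /andP[h3 h4] /(congr1 val) /=.
  rewrite !inordK => [e'| |]; last 2 first.
  - by lia.
  - by lia.
  by apply: pos_inj; lia.
by rewrite -(card_in_imset finj) max_card.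
Qed.

Local Notation q := (@law k).

(** Chebyshev's inequality. The second moment of the count is a sum over pairs of blocks, of which
    at most [2 * J + 1] per block are near. *)
Lemma cnt_deviation (a : word A k) (eta : R) : 0 <= eta ->
  pr P [set w | eta * #|I|%:R < `|(cnt (blks w) a)%:R - #|I|%:R * q a| ] * (eta * #|I|%:R) ^+ 2
    <= e * #|I|%:R ^+ 2 + (2 * J).+1%:R * #|I|%:R.
Proof.
move=> eta0; set n : R := #|I|%:R.
have n0 : 0 <= n by exact: ler0n.
pose rho f := pr P [set w | blks w = f].
have rho0 f : 0 <= rho f by exact: pr_ge0.
have cntE (f : {ffun I -> word A k}) : (cnt f a)%:R = \sum_i (f i == a)%:R :> R.
  rewrite /cnt -sum1_card natr_sum big_mkcond /=; apply: eq_bigr => i _.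
  by rewrite inE; case: eqP.
have E (h : pred {ffun I -> word A k}) : pr P [set w | h (blks w)] = \sum_f rho f * (h f)%:R.
  rewrite (pr_fin P h fmeas_blks) big_mkcond; apply: eq_bigr => f _.
  by case: (h f); rewrite ?mulr1 ?mulr0.
have E1 i : \sum_f rho f * (f i == a)%:R = q a.
  rewrite -(E (fun f => f i == a)) /q /law -(blk_law (pos i * u)); congr pr.
  by apply/seteqP; split=> w /=; rewrite ffunE => /eqP.
have Ec : \sum_f rho f * (cnt f a)%:R = n * q a.
  under eq_bigr do rewrite cntE mulr_sumr.
  by rewrite exchange_big (eq_bigr (fun=> q a)) // sumr_const -[LHS]mulr_natl.
have Ec2 : \sum_f rho f * (cnt f a)%:R ^+ 2 <= n ^+ 2 * (q a ^+ 2 + e) + (2 * J).+1%:R * n.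
  have -> : \sum_f rho f * (cnt f a)%:R ^+ 2
    = \sum_i \sum_j pr P [set w | (blks w i == a) && (blks w j == a)].
    under [RHS]eq_bigr do (under eq_bigr => j _ do
       rewrite (E (fun f => (f _ == a) && (f j == a)))).
    under [RHS]eq_bigr do rewrite exchange_big.
    rewrite [RHS]exchange_big; apply: eq_bigr => f _.
    under [RHS]eq_bigr do rewrite -mulr_sumr.
    rewrite -mulr_sumr; congr (_ * _); rewrite expr2 cntE mulr_suml; apply: eq_bigr => i _.
    by rewrite mulr_sumr; apply: eq_bigr => j _; case: (f i == a); rewrite /= ?mul1r ?mul0r.
  apply: le_trans (ler_sum _ (fun i _ => ler_sum _ (fun j _ => pair_any i j a))) _.
  under eq_bigr do rewrite big_split /= sumr_const.
  rewrite big_split /= sumr_const -[X in X + _ <= _]mulr_natl -[X in _ * X + _ <= _]mulr_natl -/n.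
  rewrite mulrA -expr2 lerD2l.
  apply: le_trans (_ : \sum_(i : I) (2 * J).+1%:R <= _); last by rewrite sumr_const -[leLHS]mulr_natr.
  apply: ler_sum => i _; apply: le_trans (_ : _ <= (#|finset (fun j => (pos i <= pos j + J)%N && (pos j <= pos i + J)%N)|)%:R) _.
    rewrite -sum1_card natr_sum [leRHS]big_mkcond; apply: ler_sum => j _.
    by rewrite inE; case: ifP.
  by rewrite ler_nat near_count.
have var : \sum_f rho f * ((cnt f a)%:R - n * q a) ^+ 2 <= e * n ^+ 2 + (2 * J).+1%:R * n.
  have -> : \sum_f rho f * ((cnt f a)%:R - n * q a) ^+ 2
    = \sum_f rho f * (cnt f a)%:R ^+ 2 - (n * q a) ^+ 2.
    transitivity (\sum_f (rho f * (cnt f a)%:R ^+ 2 - (2 * (n * q a)) * (rho f * (cnt f a)%:R)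
        + (n * q a) ^+ 2 * rho f)); first by apply: eq_bigr => f _; ring.
    by rewrite big_split sumrB /= -!mulr_sumr Ec (sum_law P fmeas_blks); ring.
  rewrite lerBlDr; apply: le_trans Ec2 _; rewrite le_eqVlt; apply/orP; left; apply/eqP; ring.
apply: le_trans var.
rewrite (E (fun f => eta * n < `|(cnt f a)%:R - n * q a|)) mulr_suml.
apply: ler_sum => f _; rewrite -mulrA ler_wpM2l //.
case: ltP => [lt|_]; last by rewrite mul0r sqr_ge0.
rewrite mul1r -[leRHS]real_normK ?num_real // lerXn2r ?nnegrE ?mulr_ge0 //.
exact: ltW.
Qed.

(** Union bound over the block values. *)
Lemma typ_prob (eta : R) : 0 < eta -> (0 < #|I|)%N ->
  pr P [set w | ~~ typ q eta (blks w)]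
    <= #|word A k|%:R / eta ^+ 2 * (e + (2 * J).+1%:R / #|I|%:R).
Proof.
move=> eta0 I0; have n0 : 0 < #|I|%:R :> R by rewrite ltr0n.
have B a : pr P [set w | eta * #|I|%:R < `|(cnt (blks w) a)%:R - #|I|%:R * q a| ]
    <= (e + (2 * J).+1%:R / #|I|%:R) / eta ^+ 2.
  have := cnt_deviation a (ltW eta0); rewrite -ler_pdivlMr ?exprn_gt0 ?mulr_gt0 //.
  move=> h; apply: le_trans h _; rewrite le_eqVlt; apply/orP; left; apply/eqP.
  by field; rewrite !gt_eqF.
have -> : #|word A k|%:R / eta ^+ 2 * (e + (2 * J).+1%:R / #|I|%:R)
   = \sum_(a : word A k) (e + (2 * J).+1%:R / #|I|%:R) / eta ^+ 2.
  by rewrite sumr_const -[RHS]mulr_natl; ring.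
apply: le_trans (ler_sum _ (fun a _ => B a)).
rewrite (pr_fin P (fun f => ~~ typ q eta f) fmeas_blks) big_mkcond /=.
under [leRHS]eq_bigr => a _ do rewrite (pr_fin P (fun f => eta * #|I|%:R < `|(cnt f a)%:R - #|I|%:R * q a|) fmeas_blks) big_mkcond /=.
rewrite [leRHS]exchange_big /=; apply: ler_sum => f _.
case: ifP => [|_]; last by apply: sumr_ge0 => a _; case: ifP => // _; exact: pr_ge0.
rewrite negb_forall => /existsP[a]; rewrite -ltNge => ha.
by rewrite (bigD1 a) //= ha lerDl sumr_ge0 // => b _; case: ifP => // _; exact: pr_ge0.
Qed.

End LLN.

End Process.

(** * Random channel codes *)


Section RandomCode.
Variables (R : realType) (V Y : finType) (M : nat).
Variables (p : V -> R) (c : V -> Y -> R) (good : V -> Y -> bool) (mu : R).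
Hypotheses (p0 : forall x, 0 <= p x) (p1 : \sum_x p x = 1).
Hypotheses (mu0 : 0 <= mu) (c0 : forall x y, 0 <= c x y) (c1 : forall x, \sum_y c x y = 1).
Hypothesis good_mass : forall y, \sum_(x | good x y) p x <= mu.
Implicit Types (f : {ffun 'I_M -> V}) (m : 'I_M).

Definition iid f : R := \prod_j p (f j).

Definition unique_dec f : {ffun Y -> option 'I_M} :=
  [ffun y => [pick m | good (f m) y && [forall m', (m' != m) ==> ~~ good (f m') y]]].

(** The codewords are drawn independently from [p]; the indicator makes the decoder a function of
    the codebook. *)
Definition random_code (pr : {ffun 'I_M -> V} * {ffun Y -> option 'I_M}) : R :=
  iid pr.1 * (pr.2 == unique_dec pr.1)%:R.

Lemma expect_prod (F : 'I_M -> V -> R) :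
  \sum_(f : {ffun 'I_M -> V}) \prod_j (p (f j) * F j (f j)) = \prod_j \sum_x p x * F j x.
Proof. by rewrite (bigA_distr_bigA (fun j x => p x * F j x)). Qed.

Lemma expect1 m (h : V -> R) : \sum_f iid f * h (f m) = \sum_x p x * h x.
Proof.
pose F j x := if j == m then h x else 1.
transitivity (\sum_(f : {ffun 'I_M -> V}) \prod_j (p (f j) * F j (f j))).
  apply: eq_bigr => f _; rewrite big_split /=; congr (_ * _).
  by rewrite (bigD1 m) //= /F eqxx big1 ?mulr1 // => j /negbTE->.
rewrite expect_prod (bigD1 m) //= /F eqxx [X in _ * X]big1 ?mulr1 // => j /negbTE->.
by under eq_bigr do rewrite mulr1.
Qed.

Lemma expect2 m m' (h h' : V -> R) : m' != m ->
  \sum_f iid f * (h (f m) * h' (f m')) = (\sum_x p x * h x) * (\sum_x p x * h' x).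
Proof.
move=> mm; pose F j x := if j == m then h x else if j == m' then h' x else 1.
have Fo j x : (j != m) && (j != m') -> F j x = 1.
  by rewrite /F => /andP[/negbTE-> /negbTE->].
transitivity (\sum_(f : {ffun 'I_M -> V}) \prod_j (p (f j) * F j (f j))).
  apply: eq_bigr => f _; rewrite big_split /=; congr (_ * _).
  by rewrite (bigD1 m) //= (bigD1 m') //= big1 ?mulr1 => [|j /Fo //]; rewrite /F eqxx (negbTE mm) eqxx.
rewrite expect_prod (bigD1 m) //= (bigD1 m') //= [X in _ * (_ * X)]big1 ?mulr1 => [|j jm].
  by rewrite /F eqxx (negbTE mm) eqxx.
by under eq_bigr do rewrite Fo // mulr1.
Qed.

Lemma expect0 : \sum_f iid f = 1.
Proof. by rewrite /iid -(bigA_distr_bigA (fun _ => p)) /= big1. Qed.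

Lemma iid_ge0 f : 0 <= iid f. Proof. exact: prodr_ge0. Qed.

Lemma sum_code (F : {ffun 'I_M -> V} -> {ffun Y -> option 'I_M} -> R) :
  \sum_pr random_code pr * F pr.1 pr.2 = \sum_f iid f * F f (unique_dec f).
Proof.
rewrite -(pair_bigA _ (fun f g => iid f * (g == unique_dec f)%:R * F f g)) /=.
apply: eq_bigr => f _; rewrite (bigD1 (unique_dec f)) //= eqxx mulr1 big1 ?addr0 // => g /negbTE->.
by rewrite mulr0 mul0r.
Qed.

Lemma random_code_pmf : is_pmf random_code.
Proof.
split=> [pr|]; first by rewrite mulr_ge0 ?iid_ge0.
by have := sum_code (fun _ _ => 1); under eq_bigr do rewrite mulr1; under [RHS]eq_bigr do rewrite mulr1; rewrite expect0.
Qed.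

(** Decoding fails only if the sent codeword is not good for the output or some other codeword is.
    Any other codeword is independent of the sent one and of the output, so it is good with
    probability at most [mu]. *)
Lemma random_code_err m :
  \sum_pr random_code pr * (\sum_y c (pr.1 m) y * (if pr.2 y == Some m then 0 else 1))
    <= (\sum_x \sum_y p x * c x y * (~~ good x y)%:R) + M%:R * mu.
Proof.
rewrite (sum_code (fun f g => \sum_y c (f m) y * (if g y == Some m then 0 else 1))).
have dec f y : (if unique_dec f y == Some m then 0 else 1 : R)
   <= (~~ good (f m) y)%:R + \sum_(m' | m' != m) (good (f m') y)%:R.
  case gm: (good (f m) y); last first.
    by case: ifP => _; rewrite ?lerDl ?addr_ge0 ?sumr_ge0.
  rewrite add0r; have [/existsP[m' /andP[mm gm']]|nex] := boolP [exists m', (m' != m) && good (f m') y].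
    rewrite (bigD1 m') //= gm'; case: ifP => _; last by rewrite lerDl sumr_ge0.
    by rewrite addr_ge0 ?sumr_ge0.
  have uq : [forall m', (m' != m) ==> ~~ good (f m') y].
    apply/forallP => m'; apply/implyP => mm; apply/negP => gm'.
    by move/existsP: nex; apply; exists m'; rewrite mm.
  rewrite ffunE; case: pickP => [m1 /andP[g1 _]|/(_ m)]; last by rewrite gm uq.
  suff -> : m1 = m by rewrite eqxx sumr_ge0.
  by apply/eqP/negPn/negP => mm; have /forallP/(_ m1) := uq; rewrite mm g1.
apply: (@le_trans _ _ (\sum_f iid f * (\sum_y c (f m) y * (~~ good (f m) y)%:R)
   + \sum_f iid f * (\sum_(m' | m' != m) \sum_y c (f m) y * (good (f m') y)%:R))).
  rewrite -big_split /=; apply: ler_sum => f _; rewrite -mulrDr ler_wpM2l ?iid_ge0 //.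
  rewrite exchange_big -big_split /=; apply: ler_sum => y _.
  by rewrite -mulr_sumr -mulrDr ler_wpM2l.
rewrite (expect1 m (fun x => \sum_y c x y * (~~ good x y)%:R)); apply: lerD.
  rewrite le_eqVlt; apply/orP; left; apply/eqP; apply: eq_bigr => x _.
  by rewrite mulr_sumr; apply: eq_bigr => y _; rewrite mulrA.
have muE : M%:R * mu = \sum_(m' : 'I_M) mu by rewrite sumr_const card_ord mulr_natl.
under eq_bigr do rewrite mulr_sumr.
(* There are only [M - 1] competitors; the index [m] itself adds one more nonnegative [mu] on the
   right. *)
rewrite exchange_big /= muE [leRHS](bigID (fun m' => m' != m)) /= -[leLHS]addr0.
apply: lerD; last exact: sumr_ge0.
apply: ler_sum => m' mm; under eq_bigr do rewrite mulr_sumr.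
rewrite exchange_big /=.
apply: (@le_trans _ _ (\sum_y (\sum_x p x * c x y) * mu)).
  apply: ler_sum => y _; rewrite (expect2 (fun x => c x y) (fun x => (good x y)%:R) mm).
  apply: ler_wpM2l; first by apply: sumr_ge0 => x _; rewrite mulr_ge0.
  apply: le_trans (good_mass y); rewrite [leRHS]big_mkcond /=; apply: ler_sum => x _.
  by case: (good x y); rewrite ?mulr1 ?mulr0.
rewrite -mulr_suml exchange_big /= (eq_bigr p) ?p1 ?mul1r // => x _.
by rewrite -mulr_sumr c1 mulr1.
Qed.

End RandomCode.

(** * Source words built from one ball *)


Section BlockPositions.
Variables (A I : finType) (k u N : nat) (pos : I -> nat).
Hypotheses (ku : (k <= u)%N) (pos_inj : injective pos) (posN : forall i, ((pos i).+1 * u <= N)%N).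

Lemma bpos_subproof (p : I * 'I_k) : (pos p.1 * u + p.2 < N)%N.
Proof.
apply: leq_trans (posN p.1); rewrite mulSn addnC ltn_add2r.
exact: leq_trans (ltn_ord _) ku.
Qed.

Definition bpos (p : I * 'I_k) : 'I_N := Ordinal (bpos_subproof p).

Lemma bpos_inj : injective bpos.
Proof.
move=> [i h] [i' h'] /(congr1 val) /= e.
have hu : (h < u)%N := leq_trans (ltn_ord h) ku.
have hu' : (h' < u)%N := leq_trans (ltn_ord h') ku.
have u0 : (0 < u)%N by apply: leq_ltn_trans hu.
have /pos_inj -> : pos i = pos i'.
  by have := congr1 (divn^~ u) e; rewrite !divnMDl // !divn_small // !addn0.
congr (_, _); apply: val_inj => /=.
by have := congr1 (modn^~ u) e; rewrite !modnMDl !modn_small.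
Qed.

(** The blocks occupy distinct coordinates, and dropping the gaps and the remainder only lowers a
    sum of nonnegative terms. *)
Lemma dn_zblk (R : realType) (d : A -> A -> R) (x y : word A N) :
  (forall a b, 0 <= d a b) ->
  \sum_i dn d (zblk bpos x i) (zblk bpos y i) <= dn d x y.
Proof.
move=> dge0; rewrite /dn pair_big /=.
rewrite [leRHS](bigID (mem [set bpos p | p in [set: I * 'I_k]])) /= -[leLHS]addr0.
apply: lerD; last exact: sumr_ge0.
rewrite big_imset /=; last by move=> p p' _ _; exact: bpos_inj.
rewrite le_eqVlt; apply/orP; left; apply/eqP; apply: eq_big => [[i h]|[i h] _]; first by rewrite inE.
by rewrite !ffunE.
Qed.

Lemma blks_zblk (d0 : measure_display) (T : measurableType d0) (X : nat -> T -> A) (w : T) :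
  blks X k u pos w = zblk bpos (Xn X N w).
Proof. by apply/ffunP => i; rewrite !ffunE; apply/ffunP => h; rewrite !ffunE. Qed.

End BlockPositions.

Lemma row_major_bound l m j i : (j < l)%N -> (i < m)%N -> ((j * m + i).+1 <= l * m.+1)%N.
Proof.
move=> jl im; apply: leq_trans (_ : (j.+1 * m <= _)%N); first by rewrite mulSn addnC ltn_add2r.
by rewrite leq_mul.
Qed.

Section CoverAtN.
Variables (R : realType) (A : finType) (d : A -> A -> R) (D : R).
Hypotheses (dge0 : forall x y, 0 <= d x y) (dxx : forall x, d x x = 0) (D0 : 0 <= D).
Variables (k u n0 : nat) (q : word A k -> R) (eta : R) (y0 : word A n0).
Hypotheses (ku : (k <= u)%N) (u0 : (0 < u)%N).
Hypotheses (q0 : forall a, 0 <= q a) (q1 : \sum_a q a = 1).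

Let m := (n0 %/ u)%N.

Lemma pos1N (i : 'I_m) : ((i : nat).+1 * u <= n0)%N.
Proof. by rewrite -leq_divRL //; exact: ltn_ord. Qed.

Definition good_blocks : {set {ffun 'I_m -> word A k}} :=
  [set z | typ q eta z &&
     (\sum_i dn d (z i) (zblk (bpos ku pos1N) y0 i) <= n0%:R * D)].

Section Long.
Variable N : nat.
(** Number of copies of [y0]. Dividing by [m.+1] ensures [l * n0 <= N], because [n0 < m.+1 * u]; the
    copies together then stay within the distortion budget [N * D]. *)
Let l := (N %/ u %/ m.+1)%N.

Definition pos2 (p : 'I_l * 'I_m) : nat := (p.1 * m + p.2)%N.

Lemma pos2_inj : injective pos2.
Proof.
move=> [j i] [j' i']; rewrite /pos2 /= => e.
have m0 : (0 < m)%N by exact: leq_ltn_trans (leq0n _) (ltn_ord i).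
congr (_, _); apply: val_inj => /=.
  by have := congr1 (divn^~ m) e; rewrite !divnMDl // !divn_small // !addn0.
by have := congr1 (modn^~ m) e; rewrite !modnMDl !modn_small.
Qed.

Lemma lm1u : (l * m.+1 * u <= N)%N.
Proof.
by apply: leq_trans (leq_trunc_div N u); rewrite leq_mul2r leq_trunc_div orbT.
Qed.

Lemma pos2N (p : 'I_l * 'I_m) : ((pos2 p).+1 * u <= N)%N.
Proof.
apply: leq_trans lm1u; rewrite leq_mul2r; apply/orP; right; rewrite /pos2.
exact: row_major_bound.
Qed.

(** [typical_cover] is applied to the [l]-fold power of [good_blocks], of mass [al ^+ l], and
    [source_words] turns the permutations into words, with the blocks of [y0] repeated [l] times as
    pattern. *)
Lemma cover_words (be : R) (K : nat) (a0 : A) :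
  let al := \sum_(z in good_blocks) wt q z in
  let I : finType := ('I_l * 'I_m)%type in
  0 < al -> #|I|%:R * #|word A k|%:R * (#|I|.+1%:R ^+ #|word A k|) < K%:R * al ^+ l ->
  N%:R - k%:R * #|I|%:R + k%:R * (2 * eta * #|word A k|%:R * #|I|%:R) <= be * N%:R ->
  exists2 C : {set word A N}, (#|C| <= K * #|sparse A be N|)%N &
    forall x, typ q eta (zblk (bpos ku pos2N) x) -> exists2 w, w \in C & dn d x w <= N%:R * D.
Proof.
move=> al I al0 hK hN.
have [||||L sL Lcov] := @typical_cover R I (word A k) q eta q0 q1 (setpow l good_blocks) (al ^+ l) K.
- by apply: typ_setpow => z; rewrite inE => /andP[].
- by rewrite exprn_gt0.
- by rewrite wt_setpow.
- exact: hK.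
pose y (p : I) := zblk (bpos ku pos1N) y0 p.2.
have Gd g : g \in setpow l good_blocks -> \sum_p dn d (g p) (y p) <= N%:R * D.
  rewrite inE => /forallP gG.
  apply: le_trans (_ : \sum_(j < l) n0%:R * D <= _).
    rewrite (_ : \sum_p _ = \sum_(j < l) \sum_(i < m) dn d (g (j, i)) (y (j, i))); last first.
      by rewrite [RHS]pair_bigA; apply: eq_bigr => -[j i].
    apply: ler_sum => j _; have := gG j; rewrite inE => /andP[_].
    by under eq_bigr do rewrite ffunE.
  rewrite sumr_const card_ord -[leLHS]mulr_natl mulrA ler_wpM2r // -natrM ler_nat.
  apply: leq_trans lm1u; rewrite -mulnA leq_mul2l; apply/orP; right.
  by rewrite ltnW // ltn_ceil.
have [C hC Ccov] := source_words (@bpos_inj _ _ _ _ pos2 ku pos2_inj pos2N) dge0 dxx a0 Gd Lcov hN.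
by exists C; rewrite -?sL.
Qed.

End Long.
End CoverAtN.

(** * Estimates *)


Section Estimates.
Variable R : realType.
Implicit Types (ka c r : R).

Lemma le_natr_bound c n : (Num.bound c <= n)%N -> c <= n%:R.
Proof.
move=> cn; have [c0|c0] := leP 0 c; last by apply: le_trans (ltW c0) _; exact: ler0n.
by apply: le_trans (ltW (archi_boundP c0)) _; rewrite ler_nat.
Qed.

Lemma succ_le_expR ka : 0 < ka -> exists N0, forall N, (N0 <= N)%N -> N.+1%:R <= expR (ka * N%:R).
Proof.
move=> ka0; exists (Num.bound (4 / ka ^+ 2)) => N /le_natr_bound.
rewrite ler_pdivrMr ?exprn_gt0 // => hN.
(* The square of the linear bound for [expR] at half the argument outgrows [N + 1] once
   [N >= 4 / ka ^+ 2]. *)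
apply: le_trans (_ : (1 + ka * N%:R / 2) ^+ 2 <= _).
  have : N%:R * 4 <= N%:R * (N%:R * ka ^+ 2) by rewrite ler_wpM2l ?ler0n.
  have : 0 <= ka * N%:R by rewrite mulr_ge0 ?ler0n // ltW.
  rewrite -natr1; nra.
rewrite {2}(_ : ka * N%:R = (ka * N%:R / 2) * 2%:R); last by rewrite divfK.
rewrite expRM_natr lerXn2r ?nnegrE ?expR_ge0 //; last exact: expR_ge1Dx.
by rewrite addr_ge0 // divr_ge0 // mulr_ge0 ?ler0n // ltW.
Qed.

(** The power [b + 3] of [N + 1] is below the exponential by [succ_le_expR]; the three spare factors
    absorb [c], [N], the summand 1 and the factor 2. *)
Lemma poly_le_expR c b ka : 0 < ka ->
  exists N0, forall N, (N0 <= N)%N -> 2 * (c * N%:R * N.+1%:R ^+ b + 1) <= expR (ka * N%:R).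
Proof.
move=> ka0; have kb0 : 0 < ka / b.+3%:R by rewrite divr_gt0 // ltr0n.
have [N0 hN0] := succ_le_expR kb0.
exists (maxn (maxn N0 (Num.bound c)) 3) => N.
rewrite !geq_max => /andP[/andP[/hN0 h1 /le_natr_bound h2] h3].
apply: le_trans (_ : N.+1%:R ^+ b.+3 <= _); last first.
  rewrite [X in expR X](_ : _ = ka / b.+3%:R * N%:R * b.+3%:R); last by field.
  by rewrite expRM_natr lerXn2r ?nnegrE ?ler0n ?expR_ge0.
set n : R := N.+1%:R in h1 *.
have nE : N%:R = n - 1 by rewrite /n -natr1 addrK.
have n4 : 4 <= n by rewrite /n ler_nat.
clearbody n.
have p1 : 1 <= n ^+ b by rewrite exprn_ege1 //; lra.
rewrite !exprS; rewrite nE in h2 *.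
have -> : n * (n * (n * n ^+ b)) = n ^+ 3 * n ^+ b by ring.
apply: le_trans (_ : 2 * ((n - 1) * (n - 1) * n ^+ b + 1) <= _).
  rewrite ler_wpM2l // lerD2r ler_wpM2r ?exprn_ge0 //; first lra.
  rewrite ler_wpM2r //; lra.
have : 2 * ((n - 1) * (n - 1) + 1) * n ^+ b <= n ^+ 3 * n ^+ b.
  rewrite ler_wpM2r ?exprn_ge0 //; first lra.
  by rewrite !exprS expr0; nra.
nra.
Qed.

Lemma msize_bounds r n : 0 <= r ->
  (msize r n)%:R <= expR (r * ln 2 * n%:R) /\ expR (r * ln 2 * n%:R) <= 2 * (msize r n)%:R.
Proof.
move=> r0; rewrite /msize; have x0 : 0 <= n%:R * r by rewrite mulr_ge0 ?ler0n.
have f0 : 0 <= Num.floor (n%:R * r) by rewrite floor_ge0.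
rewrite f0; case: (Num.floor (n%:R * r)) f0 (floor_le (n%:R * r)) (floorD1_gt (n%:R * r)) => // p _ h1 h2.
rewrite /= natrX -[X in X ^+ p](@lnK R) ?posrE // -!expRM_natr.
rewrite -[X in _ /\ _ <= X * _](@lnK R) ?posrE // -expRD !ler_expR.
have l2 : 0 < ln 2 :> R by rewrite ln_gt0 // ltr1n.
rewrite rmorphD /= in h2; rewrite /= in h1.
split; nra.
Qed.

End Estimates.

(** * Achievability *)


Lemma squeeze0 (R : realType) (f b : nat -> R) (N0 : nat) :
  (forall N, (N0 <= N)%N -> 0 <= f N <= b N) -> (b @ \oo --> 0)%classic -> (f @ \oo --> 0)%classic.
Proof.
move=> h b0; apply: (@squeeze_cvgr _ _ _ _ (fun=> 0) b) b0; last exact: cvg_cst.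
by exists N0.
Qed.

Lemma cvg0_le (R : realType) (b : nat -> R) : (forall N, 0 <= b N) ->
  (forall e, 0 < e -> exists N0, forall N, (N0 <= N)%N -> b N <= e) -> (b @ \oo --> 0)%classic.
Proof.
move=> b0 h; apply/cvgr0Pnorm_le => e e0; have [N0 hN] := h e e0.
by exists N0 => // N /hN; rewrite ger0_norm.
Qed.

Lemma codebook (V : finType) (v0 : V) (C : {set V}) (M : nat) (g : V -> V -> bool) :
  (#|C| <= M)%N -> (0 < M)%N ->
  exists (e : V -> 'I_M) (f : 'I_M -> V), forall x c, c \in C -> g x c -> g x (f (e x)).
Proof.
move=> CM M0.
pose f (i : 'I_M) := nth v0 (enum C) i.
pose ch x := odflt v0 [pick c in C | g x c].
exists (fun x => insubd (Ordinal M0) (index (ch x) (enum C))), f => x c cC gc.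
have [chC gch] : ch x \in C /\ g x (ch x).
  by rewrite /ch; case: pickP => [c' /andP[]//|/(_ c)]; rewrite cC gc.
have lt : (index (ch x) (enum C) < M)%N.
  by apply: leq_trans CM; rewrite cardE index_mem mem_enum.
by rewrite /f val_insubd lt nth_index ?mem_enum.
Qed.

Section Achievability.
Variables (R : realType) (A : finType).
Variables (d0 : measure_display) (T : measurableType d0) (P : probability T R) (X : nat -> T -> A).
Variables (d : A -> A -> R) (D : R).
Hypotheses (hX : process X) (hS : stationary P X) (hpsi : psi_mixing P X).
Hypotheses (dge0 : forall x y, 0 <= d x y) (dxx : forall x, d x x = 0) (D0 : 0 < D).
Local Open Scope classical_set_scope.

Lemma inhabited_alphabet : exists a : A, True.
Proof.
have [w _] : exists w : T, True.
  apply: contrapT => /forallNP nT.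
  have := probability_setT P; rewrite (_ : setT = set0) ?measure0 => [/eqP|].
    by rewrite lt_eqF.
  by apply/seteqP; split=> w; have := nT w.
by exists (X 0%N w).
Qed.

(** A covering set serves as the codebook, and the encoder picks a covering word. Below the
    threshold any code will do; length 0 is put there too, as the distortion is divided by [N]. *)
Lemma achievable_of_cover (r : R) (b : nat -> R) (N0 : nat) : 0 <= r ->
  b @ \oo --> 0 ->
  (forall N, (N0 <= N)%N -> exists2 C : {set word A N}, (#|C| <= msize r N)%N &
     pr P [set w | ~~ [exists c in C, dn d (Xn X N w) c <= N%:R * D]] <= b N) ->
  src_achievable P X d D r.
Proof.
move=> r0 b0 hC; have [a0 _] := inhabited_alphabet.
have M0 N : (0 < msize r N)%N.
  by have [_] := msize_bounds N r0; case: msize => // /(lt_le_trans (expR_gt0 _)); rewrite mulr0 ltxx.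
have code N : exists ef : (word A N -> 'I_(msize r N)) * ('I_(msize r N) -> word A N),
    (maxn N0 1 <= N)%N -> excess P X d D (fun x => ef.2 (ef.1 x)) <= b N.
  have [N1|N1] := leqP (maxn N0 1) N; last first.
    by exists (fun=> Ordinal (M0 N), fun=> [ffun=> a0]).
  move: N1; rewrite geq_max => /andP[N1 Npos].
  have [C Cc Cb] := hC N N1.
  have [e [f ef]] := codebook [ffun=> a0] (fun x c => dn d x c <= N%:R * D) Cc (M0 N).
  exists (e, f) => _; apply: le_trans Cb; apply: le_pr.
  - exact: (fmeas_pred (fun x => D < dn d x (f (e x)) / N%:R) (@fmeas_Xn _ _ _ _ hX N)).
  - exact: (fmeas_pred (fun x : word A N => ~~ [exists c in C, dn d x c <= N%:R * D]) (@fmeas_Xn _ _ _ _ hX N)).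
  - move=> w /=; apply: contraTN => /existsP[c /andP[cC gc]].
    rewrite -leNgt ler_pdivrMr ?ltr0n // mulrC; exact: (ef _ c).
pose ef N := projT1 (cid (code N)).
have hef N := projT2 (cid (code N)) : (_ -> excess P X d D (fun x => (ef N).2 ((ef N).1 x)) <= b N).
exists (fun N => (ef N).1), (fun N => (ef N).2).
by apply: (squeeze0 (N0 := maxn N0 1)) b0 => N hN; rewrite pr_ge0 hef.
Qed.

Lemma psi_small (e : R) : 0 < e -> exists tau, (psi P X tau <= e%:E)%E.
Proof.
move=> e0.
have e0' : (0%E < e%:E :> \bar R)%E by rewrite lte_fin.
have /= := hpsi (open_ereal_lt' e0').
by case=> n _ /(_ n (leqnn n)) /ltW h; exists n.
Qed.

End Achievability.


Lemma double_eighth (R : realType) (x be : R) : x <= be / 8 -> 2 * x <= be / 4.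
Proof. lra. Qed.

(** Three sources of letters outside the blocks and one of mismatched letters each receive a quarter
    of the correction budget [be * n]. *)
Lemma four_quarters (R : realType) (be n t i x y z f : R) :
  n <= t -> t - i = x + y + z -> x <= be / 4 * n -> y <= be / 4 * n -> z <= be / 4 * n ->
  f <= be / 4 * n -> n - i + f <= be * n.
Proof. lra. Qed.

(** * From one heavy ball to a source code *)

Section Key.
Variables (R : realType) (A : finType).
Variables (d0 : measure_display) (T : measurableType d0) (P : probability T R) (X : nat -> T -> A).
Variables (d : A -> A -> R) (D : R).
Hypotheses (hX : process X) (hS : stationary P X) (hpsi : psi_mixing P X).
Hypotheses (dge0 : forall x y, 0 <= d x y) (dxx : forall x, d x x = 0) (D0 : 0 < D).
Local Open Scope classical_set_scope.

Lemma card_word_gt0 k : (0 < #|word A k|)%N.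
Proof. by have [a _] := inhabited_alphabet P X; apply/card_gt0P; exists [ffun=> a]. Qed.

Lemma typ_prob_small k u (eta e : R) : (0 < k)%N -> (k <= u)%N -> 0 < eta -> 0 < e ->
  exists L, forall (I : finType) (pos : I -> nat), injective pos -> (L <= #|I|)%N ->
    pr P [set w | ~~ typ (law P X (k := k)) eta (blks X k u pos w)] <= e.
Proof.
move=> k0 ku eta0 e0.
pose c : R := #|word A k|%:R / eta ^+ 2.
have c0 : 0 < c by rewrite divr_gt0 ?exprn_gt0 // ltr0n card_word_gt0.
have e1 : 0 < e / 2 / c by apply: divr_gt0 => //; apply: divr_gt0.
have [J hJ] := psi_small hpsi e1.
(* Half of [e] pays for the mixing error, fixed through [J]; enough blocks then push the near pairs
   below the other half. *)
exists (Num.bound ((2 * J).+1%:R / (e / 2 / c))).+1 => I pos pinj hI.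
have I0 : (0 < #|I|)%N by exact: leq_trans hI.
apply: le_trans (typ_prob hX hS k0 ku pinj (ltW e1) hJ eta0 I0) _.
rewrite -/c; apply: le_trans (_ : c * (e / 2 / c + e / 2 / c) <= _); last first.
  by rewrite le_eqVlt; apply/orP; left; apply/eqP; field; rewrite gt_eqF.
rewrite ler_wpM2l ?(ltW c0) // lerD2l ler_pdivrMr ?ltr0n // [leRHS]mulrC -ler_pdivrMr //.
by apply: le_natr_bound; exact: ltnW.
Qed.


(** Restricting to the blocks only enlarges the event, and [blocks_upper] exchanges the true law of
    the blocks for the product law. *)
Lemma word_ball_mass k u tau n (e eta : R) (y : word A n)
    (ku : (k <= u)%N) (u0 : (0 < u)%N) :
  (0 < k)%N -> u = (k + tau)%N -> 0 <= e -> (psi P X tau <= e%:E)%E ->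
  pr P [set w | typ (law P X (k := k)) eta (zblk (bpos ku (pos1N u0)) (Xn X n w))
                && (dn d (Xn X n w) y <= n%:R * D)]
    <= (1 + e) ^+ (n %/ u) * \sum_(z in good_blocks d D (law P X (k := k)) eta y ku u0) wt (law P X (k := k)) z.
Proof.
move=> k0 uE e0 he; have [a0 _] := inhabited_alphabet P X.
set q := law P X (k := k); set G := good_blocks _ _ _ _ _ _ _.
pose pos : 'I_(n %/ u) -> nat := fun i => i.
have mb : fmeas (blks X k u pos) by exact: fmeas_blks.
apply: (@le_trans _ _ (pr P [set w | blks X k u pos w \in G])).
  apply: le_pr.
  - exact: (fmeas_pred (fun x : word A n => typ q eta (zblk (bpos ku (pos1N u0)) x)
       && (dn d x y <= n%:R * D)) (@fmeas_Xn _ _ _ _ hX n)).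
  - exact: (fmeas_pred (fun z => z \in G) mb).
  - move=> w /= /andP[h1 h2]; rewrite (blks_zblk ku (pos1N u0)) inE h1 /=.
    by apply: le_trans h2; apply: (dn_zblk ku _ (pos1N u0)) => // i j; exact: val_inj.
rewrite (pr_fin P (fun z => z \in G) mb) mulr_sumr; apply: ler_sum => z _.
pose zn (i : nat) := odflt [ffun=> a0] (omap z (insub i)).
have znE (i : 'I_(n %/ u)) : zn i = z i by rewrite /zn valK.
have := blocks_upper hX hS k0 uE e0 he (n %/ u) zn.
rewrite (_ : [set w | _] = [set w | blks X k u pos w = z]); last first.
  apply/seteqP; split=> w /= => [/forallP h|h].
    by apply/ffunP => i; rewrite ffunE -znE; exact/eqP.
  by apply/forallP => i; rewrite znE -h ffunE.
move=> h; apply: le_trans h _; rewrite /wt le_eqVlt; apply/orP; left; apply/eqP; congr (_ * _).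
by apply: eq_bigr => i _; rewrite znE.
Qed.

(** Rate count at length [N], in exponents: [r1 * ln 2 + ka] for the permutations, [ka] for the
    polynomial number of types, [ka] for the sparse corrections. *)
Lemma achievable_of_mass k u tau n0 (r1 r2 ka be eta : R) (y0 : word A n0)
    (ku : (k <= u)%N) (u0 : (0 < u)%N) :
  let q := law P X (k := k) in let m := (n0 %/ u)%N in
  (0 < k)%N -> u = (k + tau)%N -> 0 <= r1 -> 0 < ka -> r1 * ln 2 + 3 * ka <= r2 * ln 2 ->
  (forall N, #|sparse A be N|%:R <= expR (ka * N%:R)) ->
  0 < be -> 0 < eta -> eta * #|word A k|%:R <= be / 8 ->
  tau%:R <= be / 4 * u%:R -> 1 <= be / 4 * m.+1%:R -> (0 < m)%N ->
  expR (- (r1 * ln 2 + ka) * n0%:R) <= \sum_(z in good_blocks d D q eta y0 ku u0) wt q z ->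
  src_achievable P X d D r2.
Proof.
move=> q m k0 uE r10 ka0 r12 hsp be0 eta0 etaB hbt hbm m0.
set al := \sum_(z in _) _ => hal.
have [a0 _] := inhabited_alphabet P X.
have l2 : 0 < ln 2 :> R by rewrite ln_gt0 // ltr1n.
have r20 : 0 <= r2.
  have : 0 <= r2 * ln 2 by apply: le_trans r12; rewrite addr_ge0 ?mulr_ge0 // ltW.
  by rewrite pmulr_lge0.
have al0 : 0 < al by apply: lt_le_trans hal; exact: expR_gt0.
pose l N := (N %/ u %/ m.+1)%N.
pose II N : finType := ('I_(l N) * 'I_m)%type.
pose ps N : II N -> nat := @pos2 u n0 N.
pose b N := pr P [set w | ~~ typ q eta (blks X k u (@ps N) w)].
have cardI N : #|II N| = (l N * m)%N by rewrite card_prod !card_ord.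
have bto : b @ \oo --> 0.
  apply: cvg0_le => [N|e e0]; first exact: pr_ge0.
  have [L hL] := typ_prob_small k0 ku eta0 e0.
  exists (L * m.+1 * u)%N => N hN; apply: hL; first exact: pos2_inj.
  rewrite cardI; apply: leq_trans (leq_pmulr _ m0).
  by rewrite /l !leq_divRL.
pose B : nat := #|word A k|.
have [N1 hN1] := poly_le_expR B%:R B ka0.
apply: (achievable_of_cover (N0 := maxn N1 (Num.bound (4 / be * (m.+1 * u)%:R))) hX r20 bto) => N.
rewrite geq_max => /andP[/hN1 hpoly /le_natr_bound hNbig].
pose I := II N.
have lmN : (#|I| * k <= N)%N.
  rewrite cardI; apply: leq_trans (lm1u u n0 N); rewrite -/m -/(l N).
  by apply: leq_mul => //; apply: leq_mul.
have lN : (l N * m.+1 * u <= N)%N by exact: lm1u.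
have IN : (#|I| <= N)%N by apply: leq_trans lmN; rewrite leq_pmulr.
pose poly : R := #|I|%:R * B%:R * #|I|.+1%:R ^+ B.
pose x : R := poly / al ^+ l N.
have x0 : 0 <= x by rewrite divr_ge0 ?mulr_ge0 ?exprn_ge0 ?ler0n // ltW.
pose K := (Num.truncn x).+1.
have hK : poly < K%:R * al ^+ l N.
  by rewrite -ltr_pdivrMr ?exprn_gt0 //; exact: truncnS_gt.
(* The letters outside the blocks are the tail after the last full group of [m.+1] slots ([F3]), one
   slot per copy ([lu]) and the gaps ([lmt]); [F5] bounds the mismatched blocks. *)
have hN : N%:R - k%:R * #|I|%:R + k%:R * (2 * eta * #|word A k|%:R * #|I|%:R) <= be * N%:R.
  have F1 : #|I|%:R * k%:R <= N%:R :> R by rewrite -natrM ler_nat.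
  have F2 : N%:R <= ((l N)%:R + 1) * m.+1%:R * u%:R :> R.
    rewrite natr1 -!natrM ler_nat ltnW // -ltn_divLR // ltn_ceil //.
  have F3 : m.+1%:R * u%:R <= be / 4 * N%:R.
    have be4 : 0 <= be / 4 by rewrite divr_ge0 // ltW.
    apply: le_trans (ler_wpM2l be4 hNbig); rewrite natrM le_eqVlt.
    by apply/orP; left; apply/eqP; field; rewrite gt_eqF.
  have F4 : (l N)%:R * m.+1%:R * u%:R <= N%:R :> R by rewrite -!natrM ler_nat.
  have uE' : u%:R = k%:R + tau%:R :> R by rewrite uE natrD.
  have lu : (l N)%:R * u%:R <= be / 4 * N%:R.
    apply: le_trans (_ : (l N)%:R * u%:R * (be / 4 * m.+1%:R) <= _).
      by rewrite ler_peMr ?mulr_ge0 ?ler0n.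
    rewrite (_ : _ * _ = be / 4 * ((l N)%:R * m.+1%:R * u%:R)); last by ring.
    by rewrite ler_wpM2l // divr_ge0 // ltW.
  have lmt : (l N)%:R * m%:R * tau%:R <= be / 4 * N%:R.
    apply: le_trans (_ : (l N)%:R * m%:R * (be / 4 * u%:R) <= _).
      by rewrite ler_wpM2l ?mulr_ge0 ?ler0n.
    rewrite (_ : _ * _ = be / 4 * ((l N)%:R * m%:R * u%:R)); last by ring.
    rewrite ler_wpM2l // ?divr_ge0 // ?(ltW be0) //; apply: le_trans F4.
    by rewrite ler_wpM2r ?ler0n // ler_wpM2l ?ler0n // ler_nat.
  have F5 : k%:R * (2 * eta * #|word A k|%:R * #|I|%:R) <= be / 4 * N%:R.
    rewrite (_ : _ * _ = 2 * (eta * #|word A k|%:R) * (#|I|%:R * k%:R)); last by ring.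
    have h : 2 * (eta * #|word A k|%:R) <= be / 4 by exact: double_eighth.
    have be4 : 0 <= be / 4 by rewrite divr_ge0 // ltW.
    apply: le_trans (ler_wpM2l be4 F1); apply: ler_wpM2r h.
    by apply: mulr_ge0; exact: ler0n.
  have iE : #|I|%:R = (l N)%:R * m%:R :> R by rewrite cardI natrM.
  have mE : m.+1%:R = m%:R + 1 :> R by rewrite natr1.
  have e2 : ((l N)%:R + 1) * m.+1%:R * u%:R - k%:R * #|I|%:R
     = m.+1%:R * u%:R + (l N)%:R * u%:R + (l N)%:R * m%:R * tau%:R :> R.
    by rewrite iE mE uE'; ring.
  exact: four_quarters F2 e2 F3 lu lmt F5.
have [C Cc Ccov] := cover_words dge0 dxx (ltW D0) (fun a => pr_ge0 P _)
    (sum_law P (@fmeas_wblk _ _ _ _ hX k 0)) a0 al0 hK hN.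
exists C; last first.
  apply: le_pr.
  - exact: (fmeas_pred (fun x : word A N => ~~ [exists c in C, dn d x c <= N%:R * D]) (@fmeas_Xn _ _ _ _ hX N)).
  - exact: (fmeas_pred (fun z => ~~ typ q eta z) (@fmeas_blks _ _ _ _ hX k u _ (@ps N))).
  - move=> w /=; apply: contraNN => hw; apply/existsP.
    have [|c cC dc] := Ccov (Xn X N w); first by rewrite -blks_zblk.
    by exists c; rewrite cC.
(* Rounding the rate down may halve the number of messages; this is the factor 2 provided for in
   [poly_le_expR]. *)
rewrite -(ler_nat R); have [_] := msize_bounds N r20.
rewrite -(ler_pM2l (ltr0n R 2)) => hM; apply: le_trans hM.
apply: le_trans (_ : expR ((r1 * ln 2 + 3 * ka) * N%:R) <= _); last first.
  by rewrite ler_expR ler_wpM2r ?ler0n.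
apply: le_trans (_ : 2 * (K%:R * #|sparse A be N|%:R) <= _).
  by rewrite ler_wpM2l // -natrM ler_nat.
set E := expR ((r1 * ln 2 + ka) * N%:R).
have E1 : 1 <= E.
  by rewrite -expR0 ler_expR mulr_ge0 ?ler0n // addr_ge0 ?mulr_ge0 // ltW.
have xE : x <= B%:R * N%:R * N.+1%:R ^+ B * E.
  rewrite /x ler_pdivrMr ?exprn_gt0 //.
  have : 1 <= E * al ^+ l N.
    apply: le_trans (_ : E * expR (- (r1 * ln 2 + ka) * n0%:R) ^+ l N <= _); last first.
      by rewrite ler_wpM2l ?expR_ge0 // lerXn2r ?nnegrE ?expR_ge0 // ltW.
    rewrite -expRM_natr -expRD -[leLHS]expR0 ler_expR mulNr mulNr -mulrA -mulrBr.
    have c0 : 0 <= r1 * ln 2 + ka by rewrite addr_ge0 ?mulr_ge0 // ltW.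
    apply: mulr_ge0 => //; rewrite subr_ge0 -natrM ler_nat mulnC.
    apply: leq_trans lN; rewrite -mulnA leq_mul2l; apply/orP; right.
    by rewrite ltnW // ltn_ceil.
  move=> hE; rewrite -(mulrA _ E); apply: le_trans (_ : poly * 1 <= _); first by rewrite mulr1.
  apply: ler_pM => //; first by rewrite /poly !mulr_ge0 ?exprn_ge0.
  rewrite /poly (mulrC B%:R); apply: ler_pM => //.
  - by rewrite ler_wpM2r // ler_nat.
  - by rewrite lerXn2r ?nnegrE // ler_nat ltnS.
have KE : K%:R <= (B%:R * N%:R * N.+1%:R ^+ B + 1) * E.
  rewrite /K -natr1 mulrDl mul1r; apply: lerD E1.
  by apply: le_trans xE; rewrite truncn_le.
rewrite mulrA; have -> : expR ((r1 * ln 2 + 3 * ka) * N%:R) = expR (ka * N%:R) * E * expR (ka * N%:R).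
  by rewrite -!expRD; congr expR; ring.
apply: ler_pM => //.
apply: (@le_trans _ _ (2 * ((B%:R * N%:R * N.+1%:R ^+ B + 1) * E))); first by rewrite ler_wpM2l.
by rewrite mulrA ler_wpM2r // ltW // expR_gt0.
Qed.

End Key.

(** * Mass of a distortion ball *)


Section Final.
Variables (R : realType) (A : finType).
Variables (d0 : measure_display) (T : measurableType d0) (P : probability T R) (X : nat -> T -> A).
Variables (d : A -> A -> R) (D : R).
Hypotheses (hX : process X) (hS : stationary P X) (hpsi : psi_mixing P X).
Hypotheses (dge0 : forall x y, 0 <= d x y) (dxx : forall x, d x x = 0) (D0 : 0 < D).
Local Open Scope classical_set_scope.

(** By contradiction: a single heavier ball at a large length would make [r2] achievable through
    [word_ball_mass] and [achievable_of_mass]. *)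
Lemma typical_ball_bound (r1 r2 : R) : 0 <= r1 -> r1 < r2 -> ~ src_achievable P X d D r2 ->
  exists (k u : nat) (eta : R) (ku : (k <= u)%N) (u0 : (0 < u)%N),
  [/\ (0 < k)%N, 0 < eta &
   exists n1, forall n (y : word A n), (n1 <= n)%N ->
    pr P [set w | typ (law P X (k := k)) eta (zblk (bpos ku (pos1N u0)) (Xn X n w))
                  && (dn d (Xn X n w) y <= n%:R * D)] <= expR (- (r1 * ln 2) * n%:R)].
Proof.
move=> r10 r12 nach.
have l2 : 0 < ln 2 :> R by rewrite ln_gt0 // ltr1n.
(* The rate gap pays three times [ka]. The constants follow in the order [be], [tau], [k], with [k]
   large enough for the gaps of length [tau] to be a negligible fraction. *)
pose ka := (r2 - r1) * ln 2 / 3.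
have ka0 : 0 < ka by rewrite divr_gt0 // mulr_gt0 // subr_gt0.
have [be be0 hsp] := sparse_count A ka0.
have [tau htau] := psi_small hpsi ka0.
pose k := (Num.bound (4 / be * tau%:R)).+1.
pose u := (k + tau)%N.
have ku : (k <= u)%N by exact: leq_addr.
have u0 : (0 < u)%N by exact: leq_trans ku.
have B0 : 0 < #|word A k|%:R :> R by rewrite ltr0n (card_word_gt0 P X).
pose eta := be / 8 / #|word A k|%:R.
have eta0 : 0 < eta by rewrite divr_gt0 // divr_gt0.
exists k, u, eta, ku, u0; split => //.
exists ((Num.bound (4 / be)).+1 * u)%N => n y hn; rewrite leNgt; apply/negP => hlt.
apply: nach; apply: (@achievable_of_mass _ _ _ _ P X d D hX hS hpsi dge0 dxx D0 k u tau n r1 r2 ka be eta y ku u0) => //.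
- by rewrite /ka le_eqVlt; apply/orP; left; apply/eqP; field.
- by rewrite /eta divfK // gt_eqF.
- have kb : 4 / be * tau%:R <= k%:R by apply: le_natr_bound; exact: leqnSn.
  have := ler_wpM2l (ltW (divr_gt0 be0 (ltr0n R 4))) kb.
  rewrite (_ : be / 4 * (4 / be * tau%:R) = tau%:R); last by field; rewrite gt_eqF.
  move=> h; apply: le_trans h _; rewrite ler_wpM2l ?ler_nat //.
  by rewrite divr_ge0 // ltW.
- have mb : 4 / be <= (n %/ u).+1%:R.
    apply: le_natr_bound; apply: leqW; rewrite leq_divRL //.
    by apply: leq_trans hn; rewrite leq_mul2r leqnSn orbT.
  have := ler_wpM2l (ltW (divr_gt0 be0 (ltr0n R 4))) mb.
  by rewrite (_ : be / 4 * (4 / be) = 1) //; field; rewrite gt_eqF.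
- by rewrite divn_gt0 //; apply: leq_trans hn; rewrite leq_pmull.
have := word_ball_mass D hX hS dge0 eta y ku u0 (ltn0Sn _) erefl (ltW ka0) htau.
move=> /(lt_le_trans hlt) /ltW; set al := \sum_(z in _) _ => h.
have al0 : 0 <= al by apply: sumr_ge0 => z _; apply: prodr_ge0 => i _; exact: pr_ge0.
have {}h : expR (- (r1 * ln 2) * n%:R) <= expR (ka * n%:R) * al.
  apply: le_trans h _; rewrite ler_wpM2r //.
  (* The accumulated mixing factor is at most [expR (ka * n)]; it accounts for the [ka] beside
     [r1 * ln 2] in the mass bound. *)
  apply: le_trans (_ : expR ka ^+ (n %/ u) <= _).
    by rewrite lerXn2r ?nnegrE ?expR_ge0 ?addr_ge0 ?ler01 ?(ltW ka0) // expR_ge1Dx.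
  rewrite -expRM_natr ler_expR ler_wpM2l ?(ltW ka0) // ler_nat.
  exact: leq_div.
rewrite -(ler_pM2l (expR_gt0 (ka * n%:R))); apply: le_trans h.
by rewrite -expRD le_eqVlt; apply/orP; left; apply/eqP; congr expR; ring.
Qed.

Lemma rate_gap (r : R) : (r%:E < RP P X d D)%E ->
  exists2 r2, r < r2 & ~ src_achievable P X d D r2.
Proof.
move=> hr.
have [r2 rr2 h2] : exists2 r2, r < r2 & (r2%:E < RP P X d D)%E.
  case: (RP P X d D) hr => [s||//].
    by rewrite lte_fin => rs; exists ((r + s) / 2); rewrite ?lte_fin ?midf_lt.
  (* The case of an infinite [RP]. *)
  by exists (r + 1); rewrite ?ltrDl ?ltry.
exists r2 => // ach; move: h2; rewrite ltNge => /negP; apply.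
by apply: ereal_inf_lbound; exists r2.
Qed.

(** * Reliable codes over the channel *)

Variable c : forall n, word A n -> word A n -> R.
Hypotheses (hc : is_channel c).

Let p n (x : word A n) : R := pr P [set w | Xn X n w = x].

Lemma reliable_of_random_code (r : R) (good : forall n, word A n -> word A n -> bool)
    (b : nat -> R) (N0 : nat) :
  (forall n, 0 <= b n) -> b @ \oo --> 0 ->
  (forall n, (N0 <= n)%N -> forall m : 'I_(msize r n),
     code_err c (random_code (@p n) (good n)) m <= b n) ->
  reliably_achievable c r.
Proof.
move=> b0 bto hb.
pose pi n : code_pair A (msize r n) n -> R := random_code (@p n) (good n).
have pmf n : is_pmf (pi n).
  by apply: random_code_pmf => [x|]; [exact: pr_ge0 | exact: (sum_law P (@fmeas_Xn _ _ _ _ hX n))].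
have err0 n m : 0 <= code_err c (pi n) m.
  apply: sumr_ge0 => q _; apply: mulr_ge0; first by have [] := pmf n.
  apply: sumr_ge0 => y _; apply: mulr_ge0; first by have [] := hc (q.1 m).
  by case: ifP.
(* Below [N0] the sum of all errors trivially bounds each of them and does not affect the limit. *)
exists pi, (fun n => if (N0 <= n)%N then b n else \sum_m code_err c (pi n) m); split=> //.
  apply: (squeeze0 (N0 := N0)) bto => n hn; rewrite hn lexx andbT; exact: b0.
move=> n m; case: leqP => [hn|_]; first exact: hb.
by rewrite (bigD1 m) //= lerDl sumr_ge0.
Qed.

Lemma cvg_expRN (ka : R) : 0 < ka -> (fun n : nat => expR (- (ka * n%:R))) @ \oo --> 0.
Proof.
move=> ka0; apply: cvg0_le => [n|e e0]; first exact: expR_ge0.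
have [N0 hN0] := succ_le_expR ka0.
exists (maxn N0 (Num.bound (e^-1))) => n; rewrite geq_max => /andP[/hN0 h1 /le_natr_bound h2].
rewrite expRN -[e]invrK lef_pV2 ?posrE ?expR_gt0 ?invr_gt0 //.
apply: le_trans h2 _; apply: le_trans h1; rewrite ler_nat; exact: leqnSn.
Qed.

Lemma reliable_below_RP (r : R) : directly_communicates P X c d D ->
  (r%:E < RP P X d D)%E -> reliably_achievable c r.
Proof.
move=> [om [om0 hom]] hr.
have l2 : 0 < ln 2 :> R by rewrite ln_gt0 // ltr1n.
have [r0|r0] := ltP r 0.
  (* For a negative rate the message set is empty from length 1 on; at length 0 it still has one
     element. *)
  apply: (@reliable_of_random_code r (fun _ _ _ => false) (fun=> 0) 1) => // [|n n1 m].
    exact: cvg_cst.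
  have : (Num.floor (n%:R * r) < 0) by rewrite floor_lt0 pmulr_rlt0 // ltr0n.
  by move=> f0; have := ltn_ord m; rewrite [X in (_ < X)%N]/msize leNgt f0.
have [r2 rr2 nach] := rate_gap hr.
(* The gap from [r] to [r1] makes the union bound over the codewords vanish; the gap from [r1] to
   [r2] feeds [typical_ball_bound]. *)
pose r1 := (r + r2) / 2.
have rr1 : r < r1 by rewrite midf_lt.
have r12 : r1 < r2 by rewrite midf_lt.
have [k [u [eta [ku [u0 [k0 eta0 [n1 hn1]]]]]]] := typical_ball_bound (le_trans r0 (ltW rr1)) r12 nach.
pose q := law P X (k := k).
pose ty n (x : word A n) := typ q eta (zblk (bpos ku (@pos1N u n u0)) x).
pose good n (x y : word A n) := ty n x && ~~ (D < dn d x y / n%:R).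
pose pos n : 'I_(n %/ u) -> nat := fun i => i.
pose bt n := pr P [set w | ~~ typ q eta (blks X k u (@pos n) w)].
pose be n := expR (- ((r1 - r) * ln 2 * n%:R)).
have bt0 : bt @ \oo --> 0.
  apply: cvg0_le => [n|e e0]; first exact: pr_ge0.
  have [L hL] := typ_prob_small hX hS hpsi k0 ku eta0 e0.
  exists (L * u)%N => n hn; apply: hL => [i j|]; first exact: val_inj.
  by rewrite card_ord leq_divRL.
apply: (@reliable_of_random_code r good (fun n => bt n + `|om n| + be n) (maxn n1 1)).
- by move=> n; rewrite !addr_ge0 ?pr_ge0 ?expR_ge0.
- rewrite -[X in _ --> X]addr0 -[X in _ --> X + _]addr0; apply: cvgD; first apply: cvgD => //.
    by rewrite -[X in _ --> X](@normr0 R R); apply: cvg_norm.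
  by apply: cvg_expRN; rewrite mulr_gt0 // subr_gt0.
move=> n; rewrite geq_max => /andP[hn npos] m.
have mX := @fmeas_Xn _ _ _ _ hX n.
have mu0 : 0 <= expR (- (r1 * ln 2) * n%:R) :> R by exact: expR_ge0.
have gm y : \sum_(x | good n x y) @p n x <= expR (- (r1 * ln 2) * n%:R).
  rewrite -(pr_fin P (fun x => good n x y) mX); apply: le_trans (hn1 n y hn).
  apply: le_pr.
  - exact: (fmeas_pred (fun x => good n x y) mX).
  - exact: (fmeas_pred (fun x => ty n x && (dn d x y <= n%:R * D)) mX).
  move=> w /= /andP[h1]; rewrite -leNgt ler_pdivrMr ?ltr0n // mulrC => h2.
  by rewrite h2 andbT.
have c0 (x y : word A n) : 0 <= c x y by have [] := hc x.
have c1 (x : word A n) : \sum_y c x y = 1 by have [] := hc x.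
apply: le_trans (random_code_err (fun x => pr_ge0 P _) (sum_law P mX) mu0 c0 c1 gm m) _.
apply: lerD.
  (* A pair fails to be good through atypicality of the input or through excess distortion; the
     channel hypothesis bounds the latter, since the codewords follow the source law. *)
  apply: (@le_trans _ _ (\sum_x \sum_y @p n x * c x y * (~~ ty n x)%:R
     + \sum_x \sum_y @p n x * c x y * (if D < dn d x y / n%:R then 1 else 0))).
    rewrite -big_split; apply: ler_sum => x _; rewrite -big_split; apply: ler_sum => y _ /=.
    rewrite -mulrDr ler_wpM2l ?mulr_ge0 ?pr_ge0 //.
    by rewrite /good negb_and negbK; case: (ty n x); case: ifP => //= _; rewrite ?addr0 ?add0r ?lerDl.
  apply: lerD; last by apply: le_trans (hom n) _; exact: ler_norm.
  rewrite /bt; under eq_set do rewrite (blks_zblk ku (pos1N u0)).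
  rewrite (pr_fin P (fun x => ~~ ty n x) mX) [leRHS]big_mkcond; apply: ler_sum => x _.
  rewrite -mulr_suml -mulr_sumr c1 mulr1.
  by case: (ty n x); rewrite ?mulr0 ?mulr1.
apply: le_trans (_ : expR (r * ln 2 * n%:R) * expR (- (r1 * ln 2) * n%:R) <= _).
  by rewrite ler_wpM2r //; have [] := msize_bounds n r0.
by rewrite -expRD le_eqVlt; apply/orP; left; apply/eqP; congr expR; ring.
Qed.

End Final.

Local Open Scope classical_set_scope.

Theorem theorem1 (R : realType) (A : finType)
  (d0 : measure_display) (T : measurableType d0) (P : probability T R)
  (X : nat -> T -> A)
  (d : A -> A -> R) (D : R)
  (c : forall n : nat, word A n -> word A n -> R) :
  process X ->
  stationary P X ->
  psi_mixing P X ->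
  (forall x y : A, 0 <= d x y) ->
  (forall x : A, d x x = 0) ->
  0 < D ->
  is_channel c ->
  directly_communicates P X c d D ->
  forall r : R, (r%:E < RP P X d D)%E -> reliably_achievable c r.
Proof.
move=> hX hS hpsi dge0 dxx D0 hc hcom r hr.
exact: (reliable_below_RP hX hS hpsi dge0 dxx D0 hc hcom hr).
Qed.
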